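(* Let $g:\mathbb{Z}\setminus\{0\}\to\mathbb{C}$ satisfy $g(m)=o(1/m)$ as $|m|\to\infty$, let $k$ be a positive integer and $a\in\mathbb{R}\setminus\{0\}$. For integers $0\le l\le j$ put $S(j,l):=\sum_{(r_0,\dots,r_l)\in\mathbb{N}_0^{l+1},\ r_0+\cdots+r_l=j-l}\prod_{h=0}^{l}(2h+1)^{2r_h}$. Then $$\sum_{m,n\in\mathbb{Z},\,m\neq 0}\frac{g(m)}{(m+a(2n+1)i)^{2k}}=\frac{\pi^{2k}}{(2a)^{2k}(2k-1)!}\sum_{1\le l\le j\le k}\left\{\binom{2k}{2j}(2l-1)!-\binom{2k}{2j+1}(2l-1)!(2l+1)\right\}(-1)^l S(j,l)\sum_{m=1}^\infty\frac{g(m)+g(-m)}{\cosh^{2l}(m\pi/(2a))},$$ $$\sum_{m,n\in\mathbb{Z},\,m\neq 0}\frac{g(m)}{(m+a(2n+1)i)^{2k+1}}=\frac{\pi^{2k+1}}{(2a)^{2k+1}(2k)!}\sum_{0\le l\le j\le k}\left\{\binom{2k}{2j}(2l)!-\binom{2k}{2j+1}(2l+1)!\right\}(-1)^l S(j,l)\sum_{m=1}^\infty\frac{\big(g(m)-g(-m)\big)\sinh(m\pi/(2a))}{\cosh^{2l+1}(m\pi/(2a))}.$$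
   Context: $i=\sqrt{-1}$, $\mathbb{N}_0$ is the set of nonnegative integers; $\binom{n}{k}=\frac{n!}{k!(n-k)!}$ for $0\le k\le n$ and $\binom{n}{k}=0$ if $k>n$. A double sum $\sum_{m,n\in\mathbb{Z},\,m\neq0}F(m,n)$ means the iterated sum $\sum_{m\in\mathbb{Z}\setminus\{0\}}\sum_{n\in\mathbb{Z}}F(m,n)$.
   Formalization: In the second formula the l=0 series of (g(m)-g(-m))tanh(mπ/(2a)) may diverge under g(m)=o(1/m); its convergence is not claimed, and when it diverges it is read as an arbitrary number, which is harmless since its total coefficient is 0. Convergence is proved for l≥1. *)

(* Defs.v *)
From Stdlib Require Import Reals ZArith.
From mathcomp Require Import all_boot.
From Coquelicot Require Import Coquelicot.

Set Implicit Arguments.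
Unset Strict Implicit.
Unset Printing Implicit Defensive.

Local Open Scope R_scope.

(* [C] carries normed-module structures over both R and C, so the structure is
   fixed explicitly. *)
Definition is_Cseries (u : nat -> C) (s : C) : Prop :=
  @is_series C_AbsRing C_NormedModule u s.

Definition ex_Cseries (u : nat -> C) : Prop :=
  @ex_series C_AbsRing C_NormedModule u.

(* Meaningful when [ex_Cseries u]; like [Series], it returns some fixed complex
   number otherwise.  In the theorem this can only happen for the tanh series,
   i.e. l = 0 in the odd case.  There S(j,0) = 1 and
   sum_(j <= k) (binom(2k,2j) - binom(2k,2j+1)) = (1 - 1)^(2k) = 0, so the terms
   with l = 0 cancel whatever that number is. *)
Definition CSeries (u : nat -> C) : C :=
  (Series (fun n => Re (u n)), Series (fun n => Im (u n))).

(* A sum over Z converges when both of its one-sided halves converge. *)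
Definition is_sumZ (f : Z -> C) (s : C) : Prop :=
  exists s1 s2 : C,
    is_Cseries (fun n => f (Z.of_nat n)) s1 /\
    is_Cseries (fun n => f (- Z.of_nat n.+1)%Z) s2 /\
    s = (s1 + s2)%C.

Definition is_sumZ_neq0 (f : Z -> C) (s : C) : Prop :=
  exists s1 s2 : C,
    is_Cseries (fun n => f (Z.of_nat n.+1)) s1 /\
    is_Cseries (fun n => f (- Z.of_nat n.+1)%Z) s2 /\
    s = (s1 + s2)%C.

(* The iterated sum over m <> 0 (outer) and n (inner) converges to [s]. *)
Definition is_double_sum (F : Z -> Z -> C) (s : C) : Prop :=
  exists G : Z -> C,
    (forall m : Z, m <> 0%Z -> is_sumZ (F m) (G m)) /\ is_sumZ_neq0 G s.

(* The filter |m| -> oo on Z. *)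
Definition Zabs_infty (P : Z -> Prop) : Prop :=
  exists N : Z, forall m : Z, (N < Z.abs m)%Z -> P m.

(* r_0 + ... + r_l = j - l forces r_h <= j - l, so the tuples range over a finite
   type; only used for l <= j. *)
Definition S_sum (j l : nat) : nat :=
  (\sum_(r : {ffun 'I_l.+1 -> 'I_(j - l).+1} | \sum_(h < l.+1) r h == j - l)
     \prod_(h < l.+1) (2 * h + 1) ^ (2 * r h))%N.

(* Main.v *)
Require Import Defs.
From Stdlib Require Import Reals ZArith Lra Lia.
From mathcomp Require Import all_boot zify.
From mathcomp Require ssralg poly.
From Coquelicot Require Import Coquelicot.

(** Write [x = m pi / (2 a)] and [theta_n = (2 n + 1) pi / 2]; up to a power of
    [pi / (2 a)], the inner sum over [n] is [E_p(x) = 2 sum_(n >= 0) Re (x + i theta_n)^(-p)].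

    The expansion [E_2(x) = - 1 / cosh^2 x] follows by iterating the duplication
    formula of [1 / sinh^2] and passing to the limit by dominated convergence.
    Differentiating term by term, [E_p = (-1)^(p-1) / (p-1)! tanh^((p-1))] for [p >= 2].

    The recurrence [S(j+1,l+1) = S(j,l) + (2l+3)^2 S(j,l+1)] of the complete homogeneous
    polynomials shows [sech^((2j)) = sum_l (-1)^l (2l)! S(j,l) / cosh^(2l+1)], and Leibniz'
    rule for [tanh = sinh * sech] then gives [tanh^((2k))].  The formula for
    [tanh^((2k-1))] is its primitive which vanishes at infinity.  Finally
    [g] is bounded and the other factors are [O(1 / cosh)], so the outer sum can be
    split into the series on the right. *)

(** * The numbers S(j,l) *)

Module SSum.
Import ssralg poly GRing.Theory.
Local Open Scope ring_scope.

(* The factors are the geometric series of [(2h+1)^2 X], truncated after degree [N]. *)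
Definition geom_prod (N l : nat) : {poly nat} :=
  \prod_(h < l) \sum_(e < N.+1) ((2 * h + 1) ^ (2 * e))%N *: 'X^e.

(** For [d <= N] this is the complete homogeneous symmetric polynomial of degree [d] in
    [1^2, 3^2, ..., (2l-1)^2]. *)
Definition gcoef (N l d : nat) : nat := ((geom_prod N l)`_d)%R.

(** Expanding the product of sums indexes the terms by functions [r], and ['X] occurs in the term of
    [r] with the sum of its values as exponent. The truncation order [j - l] matches the index type
    in [S_sum]. *)
Lemma S_sum_coef (j l : nat) : S_sum j l = gcoef (j - l) l.+1 (j - l).
Proof.
rewrite /gcoef /geom_prod bigA_distr_bigA /= coef_sum /S_sum big_mkcond /=.
apply: eq_bigr => r _.
have -> : \prod_(h < l.+1) (((2 * h + 1) ^ (2 * r h))%N *: 'X^(r h) : {poly nat})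
  = (\prod_(h < l.+1) (2 * h + 1) ^ (2 * r h))%N *: 'X^(\sum_(h < l.+1) r h)%N.
  elim/big_rec3: _ => [|h x y z _ ->]; first by rewrite scale1r.
  by rewrite -scalerAl -scalerAr scalerA -exprD.
rewrite coefZ coefXn eq_sym; case: ifP => _; [by rewrite mulr1|by rewrite mulr0].
Qed.

Lemma coef_geom_prodS (N l d : nat) : (d <= N)%N ->
  gcoef N l.+1 d =
  (\sum_(i < d.+1) gcoef N l i * (2 * l + 1) ^ (2 * (d - i)))%N.
Proof.
move=> dN; rewrite /gcoef /geom_prod big_ord_recr /= coefM; apply: eq_bigr => i _.
congr (_ * _)%N; rewrite coef_sum.
have di : (d - i < N.+1)%N by lia.
rewrite (bigD1 (Ordinal di)) //= big1 => [|e]; first by rewrite addr0 coefZ coefXn eqxx mulr1.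
by rewrite -val_eqE /= => ne; rewrite coefZ coefXn eq_sym (negbTE ne) mulr0.
Qed.

(** The recurrence of [S_sum] relates values with different [j - l], hence with different truncation
    orders. *)
Lemma coef_geom_prod_indep (l : nat) : forall N M d : nat, (d <= N)%N -> (d <= M)%N ->
  gcoef N l d = gcoef M l d.
Proof.
elim: l => [|l IH] N M d dN dM; first by rewrite /gcoef /geom_prod !big_ord0.
rewrite !coef_geom_prodS //; apply: eq_bigr => i _; have id := ltn_ord i; congr (_ * _)%N;
  apply: IH; lia.
Qed.

Lemma coef0_geom_prod (N l : nat) : gcoef N l 0 = 1%N.
Proof.
elim: l => [|l IH]; first by rewrite /gcoef /geom_prod big_ord0 coef1.
by rewrite coef_geom_prodS // big_ord1 IH /= muln0 expn0.
Qed.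

(** Put [x = (2l+1)^2]. In the convolution with the last geometric series the top term is free of
    [x]; the others share a factor [x], and what remains is the convolution of degree [d]. *)
Lemma coef_geom_prodSS (N l d : nat) : (d < N)%N ->
  gcoef N l.+1 d.+1 =
  (gcoef N l d.+1 + (2 * l + 1) ^ 2 * gcoef N l.+1 d)%N.
Proof.
move=> dN; rewrite (@coef_geom_prodS N l d.+1) // big_ord_recr /= subnn muln0 expn0 muln1.
rewrite addnC; congr (_ + _)%N; rewrite (@coef_geom_prodS N l d); last by lia.
rewrite big_distrr /=; apply: eq_bigr => i _.
by rewrite mulnCA -expnD -mulnS -subSn // -ltnS.
Qed.

Lemma S_sum_diag j : S_sum j j = 1%N.
Proof. by rewrite S_sum_coef subnn coef0_geom_prod. Qed.

Lemma S_sum_0r j : S_sum j 0 = 1%N.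
Proof.
rewrite S_sum_coef subn0 coef_geom_prodS // (bigD1 ord0) //= big1 => [|i i0].
  by rewrite /gcoef /geom_prod big_ord0 coef1 muln0 add0n exp1n.
by rewrite /gcoef /geom_prod big_ord0 coef1; case: i i0 => [[|i] Hi].
Qed.

Lemma S_sum_rec j l : (l < j)%N ->
  S_sum j.+1 l.+1 = (S_sum j l + (2 * l + 3) ^ 2 * S_sum j l.+1)%N.
Proof.
move=> lj; rewrite !S_sum_coef subSS.
have -> : (j - l = (j - l.+1).+1)%N by lia.
rewrite coef_geom_prodSS //; congr (_ + _ * _)%N; first by congr (_ ^ _)%N; lia.
by apply: coef_geom_prod_indep; lia.
Qed.
End SSum.

Import SSum.
Local Open Scope R_scope.

(** * Derivatives of sech and tanh *)

Lemma INR_addn m n : INR (m + n)%N = INR m + INR n.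
Proof. exact: plus_INR. Qed.

Lemma INR_muln m n : INR (m * n)%N = INR m * INR n.
Proof. exact: mult_INR. Qed.

Lemma sum_nS (f : nat -> R) n : sum_n f n.+1 = sum_n f n + f n.+1.
Proof. exact: sum_Sn. Qed.

Lemma sum_nSl (f : nat -> R) n : sum_n f n.+1 = f 0%N + sum_n (fun i => f i.+1) n.
Proof. by rewrite /sum_n sum_Sn_m; [rewrite -sum_n_m_S|lia]. Qed.

Lemma eq_sum_n (f g : nat -> R) n :
  (forall i, (i <= n)%N -> f i = g i) -> sum_n f n = sum_n g n.
Proof. by move=> E; apply: sum_n_ext_loc => i Hi; apply: E; lia. Qed.

Lemma sum_nD (f g : nat -> R) n :
  sum_n (fun i => f i + g i) n = sum_n f n + sum_n g n.
Proof. exact: sum_n_plus. Qed.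

Lemma sum_nZ (c : R) (f : nat -> R) n : sum_n (fun i => c * f i) n = c * sum_n f n.
Proof. exact: sum_n_mult_l. Qed.

(** Pascal's rule in summed form, which is the induction step of Leibniz' rule. *)
Lemma sum_binS (f : nat -> R) n :
  sum_n (fun i => INR 'C(n.+1, i) * f i) n.+1 =
  sum_n (fun i => INR 'C(n, i) * (f i + f i.+1)) n.
Proof.
rewrite sum_nSl bin0.
have -> : sum_n (fun i => INR 'C(n.+1, i.+1) * f i.+1) n =
  sum_n (fun i => INR 'C(n, i.+1) * f i.+1) n + sum_n (fun i => INR 'C(n, i) * f i.+1) n.
  rewrite -sum_nD; apply: eq_sum_n => i _.
  by rewrite binS INR_addn; ring.
have E := sum_nSl (fun i => INR 'C(n, i) * f i) n.
rewrite sum_nS bin0 bin_small // in E.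
have -> : sum_n (fun i => INR 'C(n, i) * (f i + f i.+1)) n =
  sum_n (fun i => INR 'C(n, i) * f i) n + sum_n (fun i => INR 'C(n, i) * f i.+1) n.
  rewrite -sum_nD; apply: eq_sum_n => i _; ring.
rewrite /= in E *; lra.
Qed.

(** The last even index [2k] has its partner [2k+1] outside the range, hence the extra term on the
    left; in the applications it carries ['C(2k, 2k+1) = 0]. *)
Lemma sum_n_even_odd (f : nat -> R) k :
  sum_n f (2 * k) + f (2 * k + 1)%N = sum_n (fun j => f (2 * j)%N + f (2 * j + 1)%N) k.
Proof.
elim: k => [|k IH]; first by rewrite !sum_O.
rewrite sum_nS -IH.
have -> : (2 * k.+1 = (2 * k + 1).+1)%N by lia.
have -> : (2 * k + 1 = (2 * k).+1)%N by lia.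
rewrite !sum_nS !addn1; ring.
Qed.

(** This is [(1 - 1)^(2k) = 0] sorted by parity; for [k = 0] the sum would be 1. *)
Lemma sum_alt_bin k : (0 < k)%N ->
  sum_n (fun j => INR 'C(2 * k, 2 * j) - INR 'C(2 * k, 2 * j + 1)) k = 0.
Proof.
case: k => // k _.
have := sum_n_even_odd (fun m => INR 'C(2 * k.+1, m) * (-1) ^ m) k.+1.
rewrite bin_small; last by lia.
have -> : (2 * k.+1 = (2 * k).+1.+1)%N by lia.
(* Pascal's rule leaves the factors [(-1)^i + (-1)^(i+1)], which vanish. *)
rewrite sum_binS (_ : sum_n _ _ = 0); last first.
  rewrite (@eq_sum_n _ (fun=> 0)); first by rewrite sum_n_const; exact: Rmult_0_r.
  by move=> i _ /=; ring.
have sgn j : (-1) ^ (2 * j) = 1.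
  by rewrite pow_mult (_ : (-1) ^ 2 = 1) ?pow1 //=; ring.
move=> E; apply: (@eq_trans R _ _ _ _ (_ : 0 + INR 0 * (-1) ^ ((2 * k).+2 + 1) = 0));
  last by rewrite /=; ring.
rewrite E; apply: eq_sum_n => j _.
by rewrite addn1 -[(-1) ^ _.+1]/(-1 * (-1) ^ (2 * j)) sgn; ring.
Qed.

Lemma cosh_gt0 x : 0 < cosh x.
Proof. by rewrite /cosh; have := exp_pos x; have := exp_pos (- x); lra. Qed.

Lemma cosh2_sinh2 x : cosh x ^ 2 = 1 + sinh x ^ 2.
Proof.
rewrite /cosh /sinh exp_Ropp; have := exp_pos x => ?; field; lra.
Qed.

Lemma is_derive_cosh x : is_derive cosh x (sinh x).
Proof. exact/is_derive_Reals/derivable_pt_lim_cosh. Qed.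

Lemma is_derive_sinh x : is_derive sinh x (cosh x).
Proof. exact/is_derive_Reals/derivable_pt_lim_sinh. Qed.

Lemma is_derive_eq (f : R -> R) (x a b : R) : is_derive f x a -> a = b -> is_derive f x b.
Proof. by move=> H <-. Qed.

Lemma is_derive_sech_pow n x :
  is_derive (fun y => / cosh y ^ n) x (- INR n * sinh x * / cosh x ^ n.+1).
Proof.
have c0 := cosh_gt0 x.
apply: is_derive_eq.
  apply: is_derive_inv; last by apply: pow_nonzero; lra.
  by apply: is_derive_pow; apply: is_derive_cosh.
case: n => [|n]; first by rewrite /=; field; lra.
have cn : cosh x ^ n <> 0 by apply: pow_nonzero; lra.
move: (INR n.+1) => N; rewrite /=; field; split; lra.
Qed.

Lemma is_derive_sinh_sech_pow n x :
  is_derive (fun y => sinh y * / cosh y ^ n.+1) x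
    (- INR n * / cosh x ^ n + INR n.+1 * / cosh x ^ n.+2).
Proof.
have c0 := cosh_gt0 x.
apply: is_derive_eq.
  apply: Derive.is_derive_mult; [exact: is_derive_sinh|exact: is_derive_sech_pow].
have cn : cosh x ^ n <> 0 by apply: pow_nonzero; lra.
rewrite S_INR.
apply: (@eq_trans R _ (/ cosh x ^ n - (INR n + 1) * sinh x ^ 2 * / cosh x ^ n.+2)).
  by rewrite /=; field; split; lra.
rewrite (_ : sinh x ^ 2 = cosh x ^ 2 - 1); last by rewrite cosh2_sinh2; ring.
by rewrite /=; field; split; lra.
Qed.

(** Coefficient of [1 / cosh^(2l+1)] in the derivative of [sech] of order [2j]. The value 0 for
    [l > j] lets the recurrence hold at [l = j] as well. *)
Definition sech_coef (j l : nat) : R :=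
  if (l <= j)%N then (-1) ^ l * INR (2 * l)`! * INR (S_sum j l) else 0.

Lemma sech_coef0 j : sech_coef j 0 = 1.
Proof. by rewrite /sech_coef leq0n S_sum_0r muln0 fact0 /=; ring. Qed.

Lemma sech_coefS j l : (l <= j)%N -> sech_coef j.+1 l.+1 =
  INR (2 * l + 3) ^ 2 * sech_coef j l.+1 - INR (2 * l + 1) * INR (2 * l + 2) * sech_coef j l.
Proof.
move=> lj; rewrite /sech_coef ltnS lj.
have -> : INR (2 * l.+1)`! = INR (2 * l + 2) * INR (2 * l + 1) * INR (2 * l)`!.
  have -> : (2 * l.+1 = (2 * l).+2)%N by lia.
  by rewrite !factS !INR_muln !(addnS, addn0); ring.
case: ltnP => lj2; last first.
  have -> : l = j by lia.
  by rewrite !S_sum_diag -[(-1) ^ j.+1]/(-1 * (-1) ^ j); ring.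
rewrite S_sum_rec // (INR_addn (S_sum _ _)) (INR_muln (_ ^ 2)) -mulnn (INR_muln (_
  + 3)) -[(-1) ^ l.+1]/(-1 * (-1) ^ l); ring.
Qed.

(** Closed form of the derivative of [sech] of order [m]. The odd case is the preceding even one
    differentiated term by term, so only the passage from odd to even uses the recurrence. *)
Definition sech_deriv (m : nat) (y : R) : R :=
  if odd m then
    sum_n (fun l => sech_coef m./2 l * (- INR (2 * l + 1) * (sinh y * / cosh y ^ (2 * l
      + 2)))) m./2
  else sum_n (fun l => sech_coef m./2 l * / cosh y ^ (2 * l + 1)) m./2.

Lemma sech_deriv_even j y :
  sech_deriv (2 * j) y = sum_n (fun l => sech_coef j l * / cosh y ^ (2 * l + 1)) j.
Proof. by rewrite /sech_deriv oddM /= mul2n doubleK. Qed.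

Lemma sech_deriv_odd j y : sech_deriv (2 * j + 1) y =
  sum_n (fun l => sech_coef j l * (- INR (2 * l + 1) * (sinh y * / cosh y ^ (2 * l + 2)))) j.
Proof. by rewrite /sech_deriv oddD oddM /= mul2n addn1 /= uphalf_double. Qed.

Lemma is_derive_sech_even j x : is_derive (sech_deriv (2 * j)) x (sech_deriv (2 * j + 1) x).
Proof.
apply: (is_derive_ext (fun y => sum_n (fun l => sech_coef j l * / cosh y ^ (2 * l + 1)) j)).
  by move=> y; rewrite sech_deriv_even.
rewrite sech_deriv_odd; apply: is_derive_sum_n => l _; apply: is_derive_scal.
apply: is_derive_eq (is_derive_sech_pow _ _) _.
by rewrite (_ : (2 * l + 1).+1 = 2 * l + 2)%N; [ring|lia].
Qed.

(** The second derivative of [sech^n] is [n^2 sech^n - n (n+1) sech^(n+2)]. For [n = 2l+1],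
    collecting equal powers gives exactly the recurrence [sech_coefS]. *)
Lemma is_derive_sech_odd j x : is_derive (sech_deriv (2 * j + 1)) x (sech_deriv (2 * j.+1) x).
Proof.
apply: is_derive_ext.
  by move=> y; rewrite sech_deriv_odd.
pose w l := / cosh x ^ (2 * l + 1).
have /is_derive_eq : is_derive (fun y => sum_n (fun l => sech_coef j l * (- INR (2 * l
  + 1) * (sinh y * / cosh y ^ (2 * l + 2)))) j) x
  (sum_n (fun l => INR (2 * l + 1) ^ 2 * sech_coef j l * w l - INR (2 * l + 1) * INR (2 * l
    + 2) * sech_coef j l * w l.+1) j).
  apply: is_derive_sum_n => l _.
  apply: is_derive_eq; first by do 2 apply: is_derive_scal;
    rewrite (_ : 2 * l + 2 = (2 * l + 1).+1)%N; [apply: is_derive_sinh_sech_pow|lia].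
  rewrite /w (_ : 2 * l.+1 + 1 = (2 * l + 1).+2)%N; last by lia.
  rewrite (_ : 2 * l + 2 = (2 * l + 1).+1)%N; last by lia.
  by ring.
apply; rewrite sech_deriv_even sum_nSl.
rewrite (@eq_sum_n _ (fun l => INR (2 * l + 1) ^ 2 * sech_coef j l * w l + - INR (2 * l
  + 1) * INR (2 * l + 2) * sech_coef j l * w l.+1)); last by move=> l _; ring.
rewrite [RHS](_ : _ = sech_coef j.+1 0 * w 0%N + sum_n (fun l => INR (2 * l.+1
  + 1) ^ 2 * sech_coef j l.+1 * w l.+1
   + - INR (2 * l + 1) * INR (2 * l + 2) * sech_coef j l * w l.+1) j); last first.
  congr (_ + _); apply: eq_sum_n => l lj; rewrite sech_coefS // /w.
  by rewrite (_ : 2 * l + 3 = 2 * l.+1 + 1)%N; [ring|lia].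
rewrite !sum_nD -Rplus_assoc; congr (_ + _).
(* The index shift is exact at both ends: the coefficient at [l = j+1] is 0, and at [l = 0] both
   coefficients and the factor [(2l+1)^2] are 1. *)
have := sum_nSl (fun l => INR (2 * l + 1) ^ 2 * sech_coef j l * w l) j.
rewrite sum_nS {2}/sech_coef ltnn !sech_coef0 muln0 /= => E.
by rewrite /=; lra.
Qed.

Lemma is_derive_sech_deriv m x : is_derive (sech_deriv m) x (sech_deriv m.+1 x).
Proof.
case: (boolP (odd m)) => om.
  have -> : (m = 2 * m./2 + 1)%N by lia.
  have -> : ((2 * m./2 + 1).+1 = 2 * m./2.+1)%N by lia.
  exact: is_derive_sech_odd.
have -> : (m = 2 * m./2)%N by lia.
rewrite -[(2 * m./2).+1]addn1; exact: is_derive_sech_even.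
Qed.

Definition sinh_deriv (m : nat) (y : R) : R := if odd m then cosh y else sinh y.

Lemma is_derive_sinh_deriv m x : is_derive (sinh_deriv m) x (sinh_deriv m.+1 x).
Proof. by rewrite /sinh_deriv /=; case: odd;
  [exact: is_derive_cosh|exact: is_derive_sinh]. Qed.

(* Leibniz' rule for [tanh = sinh * sech] *)
Definition tanh_deriv (n : nat) (y : R) : R :=
  sum_n (fun m => INR 'C(n, m) * (sinh_deriv (n - m) y * sech_deriv m y)) n.

Lemma is_derive_tanh_deriv n x : is_derive (tanh_deriv n) x (tanh_deriv n.+1 x).
Proof.
rewrite /tanh_deriv sum_binS; apply: is_derive_sum_n => m Hm; apply: is_derive_scal.
apply: is_derive_eq.
  by apply: Derive.is_derive_mult; [exact: is_derive_sinh_deriv|exact: is_derive_sech_deriv].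
by rewrite subSS subSn //; lia.
Qed.

Definition odd_coef (k j l : nat) : R :=
  (INR 'C(2 * k, 2 * j) * INR (2 * l)`! - INR 'C(2 * k, 2 * j + 1) * INR (2 * l + 1)`!)
  * (-1) ^ l * INR (S_sum j l).

Definition even_coef (k j l : nat) : R :=
  (INR 'C(2 * k, 2 * j) * INR (2 * l - 1)`!
     - INR 'C(2 * k, 2 * j + 1) * INR (2 * l - 1)`! * INR (2 * l + 1))
  * (-1) ^ l * INR (S_sum j l).

(** The factor [2l] is the one produced by differentiating [1 / cosh^(2l)]; this makes the odd-order
    formula for [tanh] a primitive of the even-order one. *)
Lemma odd_even_coef k j l : (0 < l)%N -> odd_coef k j l = INR (2 * l) * even_coef k j l.
Proof.
case: l => // l _; rewrite /odd_coef /even_coef.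
have -> : (2 * l.+1 - 1 = (2 * l).+1)%N by lia.
have -> : (2 * l.+1 + 1 = (2 * l).+3)%N by lia.
have -> : (2 * l.+1 = (2 * l).+2)%N by lia.
rewrite ((factS (2 * l).+2)) (factS (2 * l).+1) !INR_muln; ring.
Qed.

Definition dsum (c : nat -> nat -> R) (t : nat -> R) (k : nat) : R :=
  sum_n (fun j => sum_n (fun l => c j l * t l) j) k.

(** Drops the index [l = 0], where [sinh / cosh^(2l+1)] is [tanh] and does not decay. *)
Definition cut0 (t : nat -> R) (l : nat) : R := if l is 0 then 0 else t l.

Lemma eq_dsum c1 t1 c2 t2 k :
  (forall j l, (l <= j)%N -> (j <= k)%N -> c1 j l * t1 l = c2 j l * t2 l) ->
  dsum c1 t1 k = dsum c2 t2 k.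
Proof. by move=> E; apply: eq_sum_n => j jk; apply: eq_sum_n => l lj; apply: E. Qed.

(** Since [S(j,0) = 1], the terms with [l = 0] add up to [t 0] times the alternating binomial sum,
    which is 0. *)
Lemma dsum_odd_cut0 k t : (0 < k)%N -> dsum (odd_coef k) t k = dsum (odd_coef k) (cut0 t) k.
Proof.
move=> k0; suff H : dsum (odd_coef k) t k - dsum (odd_coef k) (cut0 t) k = 0 by lra.
transitivity (t 0%N * sum_n (fun j => INR 'C(2 * k, 2 * j) - INR 'C(2 * k, 2 * j + 1)) k);
  last first.
  by rewrite sum_alt_bin // Rmult_0_r.
rewrite -sum_nZ; apply: (@eq_trans R _ (sum_n (fun j =>  sum_n (fun l
  => odd_coef k j l * t l) j + -1 * sum_n (fun l => odd_coef k j l * cut0 t l) j) k)).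
  by rewrite sum_nD sum_nZ /dsum; ring.
apply: eq_sum_n => j _; rewrite -sum_nZ -sum_nD.
have H0 : odd_coef k j 0 = INR 'C(2 * k, 2 * j) - INR 'C(2 * k, 2 * j + 1).
  by rewrite /odd_coef S_sum_0r muln0 add0n fact0 factS fact0 /=; ring.
case: j H0 => [|j] H0; first by rewrite sum_O H0 /=; ring.
rewrite sum_nSl (@eq_sum_n _ (fun=> 0)) => [|l _ /=]; last by ring.
by rewrite sum_n_const H0 /=; ring.
Qed.

Lemma tanh_deriv1 y : tanh_deriv 1 y = / cosh y ^ 2.
Proof.
have c0 := cosh_gt0 y.
rewrite /tanh_deriv sum_nS sum_O bin0 bin1 /sinh_deriv /sech_deriv /= !sum_O sech_coef0 muln0
  /=.
apply: (@eq_trans R _ ((cosh y ^ 2 - sinh y ^ 2) * / cosh y ^ 2)); first by rewrite /=;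
  field; lra.
by rewrite [X in X * _](_ : _ = 1) ?Rmult_1_l // cosh2_sinh2; ring.
Qed.

(** In Leibniz' rule the even derivatives of [sech] meet [sinh] and the odd ones meet [cosh], which
    cancels one power in the denominator; the two families become the two halves of [odd_coef]. *)
Lemma tanh_deriv_even k y :
  tanh_deriv (2 * k) y = dsum (odd_coef k) (fun l => sinh y * / cosh y ^ (2 * l + 1)) k.
Proof.
have c0 := cosh_gt0 y.
have := sum_n_even_odd (fun m => INR 'C(2 * k, m) * (sinh_deriv (2 * k - m) y * sech_deriv m
  y)) k.
rewrite bin_small; last by lia.
rewrite -/(tanh_deriv (2 * k) y) Rmult_0_l Rplus_0_r => ->.
apply: eq_sum_n => j jk; rewrite sech_deriv_even sech_deriv_odd /sinh_deriv.
have -> : odd (2 * k - 2 * j) = false by lia.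
(* For [j = k] the difference [2k - (2k+1)] truncates to 0 and has the wrong parity, but the
   binomial coefficient in front is 0. *)
case: (ltnP j k) => jk2; last first.
  rewrite (@bin_small (2 * k) (2 * j + 1)); last by lia.
  rewrite Rmult_0_l Rplus_0_r -!sum_nZ; apply: eq_sum_n => l lj.
  rewrite /odd_coef /sech_coef lj (@bin_small (2 * k) (2 * j + 1)); last by lia.
  by rewrite /=; ring.
have -> : odd (2 * k - (2 * j + 1)) = true by lia.
rewrite -!sum_nZ -sum_nD; apply: eq_sum_n => l lj.
rewrite /odd_coef /sech_coef lj.
have cn : cosh y ^ (2 * l + 1) <> 0 by apply: pow_nonzero; lra.
rewrite (_ : 2 * l + 2 = (2 * l + 1).+1)%N; last by lia.
rewrite -[cosh y ^ _.+1]/(cosh y * cosh y ^ (2 * l + 1)).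
rewrite [in RHS](_ : (2 * l + 1)`! = (2 * l + 1) * (2 * l)`!)%N; last by rewrite addn1 factS.
by rewrite INR_muln; field; split; lra.
Qed.

(** * Functions dominated by [sech], and the odd derivatives of [tanh] *)

Definition sech_bounded (f : R -> R) : Prop :=
  exists K, forall y, Rabs (f y) <= K * / cosh y.

Lemma sech_bounded_ext f h : (forall y, f y = h y) -> sech_bounded f -> sech_bounded h.
Proof. by move=> E [K HK]; exists K => y; rewrite -E. Qed.

Lemma sech_bounded_plus f h : sech_bounded f -> sech_bounded h ->
  sech_bounded (fun y => f y + h y).
Proof.
move=> [K HK] [M HM]; exists (K + M) => y; have := Rabs_triang (f y) (h y).
have := HK y; have := HM y; lra.
Qed.

Lemma sech_bounded_scal c f : sech_bounded f -> sech_bounded (fun y => c * f y).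
Proof.
move=> [K HK]; exists (Rabs c * K) => y; rewrite Rabs_mult Rmult_assoc.
by apply: Rmult_le_compat_l (HK y); apply: Rabs_pos.
Qed.

Lemma sech_bounded_sum (f : nat -> R -> R) n :
  (forall l, sech_bounded (f l)) -> sech_bounded (fun y => sum_n (fun l => f l y) n).
Proof.
move=> H; elim: n => [|n IH]; first by apply: sech_bounded_ext (H 0%N) => y; rewrite sum_O.
by apply: sech_bounded_ext (sech_bounded_plus _ _ IH (H n.+1)) => y; rewrite sum_nS.
Qed.

Lemma cosh_ge1 y : 1 <= cosh y.
Proof.
have := cosh2_sinh2 y; have := cosh_gt0 y; have := pow2_ge_0 (sinh y); simpl; nra.
Qed.

Lemma sech_bounded_pow n : sech_bounded (fun y => / cosh y ^ n.+1).
Proof.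
exists 1 => y; have c1 := cosh_ge1 y; rewrite Rmult_1_l Rabs_pos_eq; last first.
  by apply/Rlt_le/Rinv_0_lt_compat/pow_lt; lra.
apply: Rinv_le_contravar; first by lra.
have := pow_R1_Rle (cosh y) n c1; simpl; nra.
Qed.

Lemma sech_bounded_sinh_pow n : sech_bounded (fun y => sinh y * / cosh y ^ n.+2).
Proof.
have [K HK] := sech_bounded_pow n; exists K => y; apply: Rle_trans (HK y).
have c0 := cosh_gt0 y.
have cn : 0 < / cosh y ^ n.+1 by apply/Rinv_0_lt_compat/pow_lt.
have -> : sinh y * / cosh y ^ n.+2 = (sinh y * / cosh y) * / cosh y ^ n.+1.
  rewrite -[cosh y ^ n.+2]/(cosh y * cosh y ^ n.+1) Rinv_mult; ring.
rewrite Rabs_mult -[X in _ <= X]Rmult_1_l; apply: Rmult_le_compat_r; first exact: Rabs_pos.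
rewrite Rabs_mult (Rabs_pos_eq (/ _)); last by apply/Rlt_le/Rinv_0_lt_compat.
apply: (Rmult_le_reg_r (cosh y)) => //; rewrite Rmult_assoc Rinv_l; last by lra.
by rewrite Rmult_1_r Rmult_1_l; apply: Rabs_le; have := cosh2_sinh2 y; rewrite /=; nra.
Qed.

Lemma sech_bounded_const_eq0 c f :
  (forall y, f y = c) -> sech_bounded f -> c = 0.
Proof.
move=> fc [K HK]; case: (Req_dec c 0) => // /Rabs_pos_lt c0.
have K0 : Rabs c <= K.
  have := HK 0; rewrite fc cosh_0 Rinv_1; lra.
(* With this [y], the bound [cosh y >= (1 + y) / 2] gives [|c| cosh y >= |c| / 2 + K > K], against
   the domination at [y]. *)
set y := 2 * K / Rabs c.
have y0 : 0 <= y by apply: Rdiv_le_0_compat; lra.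
have cy : 1 + y <= 2 * cosh y.
  have := exp_ineq1_le y; have := exp_pos (- y); rewrite /cosh; lra.
have := HK y; rewrite fc => /(Rmult_le_compat_r (cosh y) _ _ (Rlt_le _ _ (cosh_gt0 y))).
rewrite Rmult_assoc Rinv_l; last by have := cosh_gt0 y; lra.
have E : Rabs c * y = 2 * K by rewrite /y; field; lra.
by nra.
Qed.

Lemma is_derive_dsum c (t dt : nat -> R -> R) k x :
  (forall l, is_derive (t l) x (dt l x)) ->
  is_derive (fun y => dsum c (fun l => t l y) k) x (dsum c (fun l => dt l x) k).
Proof.
move=> H; apply: is_derive_sum_n => j _; apply: is_derive_sum_n => l _.
exact: is_derive_scal.
Qed.

Lemma sech_bounded_dsum c (t : nat -> R -> R) k :
  (forall l, sech_bounded (t l)) -> sech_bounded (fun y => dsum c (fun l => t l y) k).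
Proof.
move=> H; apply: sech_bounded_sum => j; apply: sech_bounded_sum => l.
exact: sech_bounded_scal.
Qed.

Lemma sech_bounded_0 : sech_bounded (fun=> 0).
Proof. by exists 0 => y; rewrite Rabs_R0; lra. Qed.

Lemma tanh_deriv_even0 k y : (0 < k)%N -> tanh_deriv (2 * k) y =
  dsum (odd_coef k) (cut0 (fun l => sinh y * / cosh y ^ (2 * l + 1))) k.
Proof. by move=> k0; rewrite tanh_deriv_even dsum_odd_cut0. Qed.

(** Differentiating the even-order formula without its [l = 0] terms leaves only positive powers of
    [sech]. The bound serves to fix the constant of integration in [tanh_deriv_odd]. *)
Lemma sech_bounded_tanh_deriv_odd k : sech_bounded (tanh_deriv (2 * k + 1)).
Proof.
case: k => [|k].
  by apply: sech_bounded_ext (sech_bounded_pow 1) => y; rewrite tanh_deriv1.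
pose t l y := cut0 (fun l => sinh y * / cosh y ^ (2 * l + 1)) l.
pose dt l y := cut0 (fun l => - INR (2 * l) * / cosh y ^ (2 * l)
  + INR (2 * l).+1 * / cosh y ^ (2 * l).+2) l.
have Hdt l x : is_derive (t l) x (dt l x).
  case: l => [|l]; first exact: is_derive_const.
  rewrite /t /dt /cut0 addn1; exact: is_derive_sinh_sech_pow.
apply: (@sech_bounded_ext (fun y => dsum (odd_coef k.+1) (fun l => dt l y) k.+1)).
  move=> y; have H := is_derive_dsum (odd_coef k.+1) t dt k.+1 y (fun l => Hdt l y).
  rewrite -(is_derive_unique _ _ _ H) addn1.
  rewrite -(is_derive_unique _ _ _ (is_derive_tanh_deriv (2 * k.+1) y)).
  by apply: Derive_ext => z; rewrite tanh_deriv_even0.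
apply: sech_bounded_dsum => -[|l]; first exact: sech_bounded_0.
apply: sech_bounded_plus; apply: sech_bounded_scal; last exact: sech_bounded_pow.
rewrite (_ : 2 * l.+1 = (2 * l).+2)%N; last by lia.
exact: sech_bounded_pow.
Qed.

(* Both sides have derivative [tanh_deriv (2 * k)] and vanish at infinity. *)
Lemma tanh_deriv_odd k y : (0 < k)%N -> tanh_deriv (2 * k - 1) y =
  - dsum (even_coef k) (cut0 (fun l => / cosh y ^ (2 * l))) k.
Proof.
move=> k0; pose t l y := cut0 (fun l => / cosh y ^ (2 * l)) l.
pose dt l y := cut0 (fun l => - INR (2 * l) * sinh y * / cosh y ^ (2 * l).+1) l.
have Hdt l x : is_derive (t l) x (dt l x).
  case: l => [|l]; first exact: is_derive_const.
  exact: is_derive_sech_pow.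
pose h y := tanh_deriv (2 * k - 1) y + dsum (even_coef k) (fun l => t l y) k.
suff H : tanh_deriv (2 * k - 1) y + dsum (even_coef k) (cut0 (fun l
  => / cosh y ^ (2 * l))) k = 0 by lra.
rewrite -[LHS]/(h y).
have Hh x : is_derive h x 0.
  apply: is_derive_eq.
    by apply: is_derive_plus; [exact: is_derive_tanh_deriv|exact: is_derive_dsum].
  have -> : ((2 * k - 1).+1 = 2 * k)%N by lia.
  rewrite tanh_deriv_even0 // /plus /=.
  (* The factor [-2l] in the derivative of [1 / cosh^(2l)] turns [even_coef] into [- odd_coef], so
     the two double sums cancel. *)
  rewrite (@eq_dsum _ _ (fun j l => - even_coef k j l) (fun l => dt l x)).
    rewrite /dsum -sum_nD (@eq_sum_n _ (fun=> 0)) ?sum_n_const; first by apply: Rmult_0_r.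
    move=> j _; rewrite -sum_nD (@eq_sum_n _ (fun=> 0)) ?sum_n_const;
      first by apply: Rmult_0_r.
    by move=> l _; ring.
  move=> j [|l] _ _; rewrite /dt /cut0; first by ring.
  by rewrite odd_even_coef // addn1; ring.
have hc z : h z = h y.
  case: (Rtotal_order z y) => [zy|[->//|yz]].
    by apply: (eq_is_derive h z y) => // ? _; apply: Hh.
  by symmetry; apply: (eq_is_derive h y z) => // ? _; apply: Hh.
apply: sech_bounded_const_eq0 hc _;  apply: sech_bounded_plus.
  case: k k0 {h t dt Hdt Hh} => // k _.
  by rewrite (_ : 2 * k.+1 - 1 = 2 * k + 1)%N; [exact: sech_bounded_tanh_deriv_odd|lia].
apply: sech_bounded_dsum => -[|l]; first exact: sech_bounded_0.
rewrite /t /cut0 (_ : 2 * l.+1 = (2 * l).+2)%N; last by lia.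
exact: sech_bounded_pow.
Qed.

(** * Partial fractions of sech^2 *)

(** The upper bound is exclusive, unlike in [sum_n], so that a range of length [2^(m+1)] splits into
    two of length [2^m]. *)
Fixpoint psum (f : nat -> R) (n : nat) : R := if n is n'.+1 then psum f n' + f n' else 0.

Lemma eq_psum f h n : (forall i, (i < n)%N -> f i = h i) -> psum f n = psum h n.
Proof.
elim: n => // n IH E /=; rewrite E // IH // => i Hi; apply: E; lia.
Qed.

Lemma psum_cat f m n : psum f (m + n) = psum f m + psum (fun i => f (m + i)%N) n.
Proof.
by elim: n => [|n IH]; rewrite ?addn0 ?addnS /=; [ring|rewrite IH; ring].
Qed.

Lemma psumSl f n : psum f n.+1 = f 0%N + psum (fun i => f i.+1) n.
Proof. by elim: n => [|n IH]; [rewrite /=; ring|rewrite -[LHS]/(psum f n.+1 + f n.+1) IH /=;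
  ring]. Qed.

Lemma psum_rev f n : psum (fun i => f (n - i.+1)%N) n = psum f n.
Proof.
elim: n => // n IH; rewrite psumSl subn1 /= -IH Rplus_comm; congr (_ + _).
Qed.

Lemma psumD f h n : psum (fun i => f i + h i) n = psum f n + psum h n.
Proof. by elim: n => [|n IH] /=; [ring|rewrite IH; ring]. Qed.

Lemma psumZ c f n : psum (fun i => c * f i) n = c * psum f n.
Proof. by elim: n => [|n IH] /=; [ring|rewrite IH; ring]. Qed.

Lemma Series_psum f n : Series (fun k => if (k < n)%N then f k else 0) = psum f n.
Proof.
have H p : sum_n (fun k => if (k < n)%N then f k else 0) p = psum f (minn n p.+1).
  elim: p => [|p IH]; first by case: n => [|[|n]]; rewrite sum_O /=; ring.
  rewrite sum_nS IH; case: (boolP (p.+1 < n)%N) => [Hp|].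
    by rewrite (minn_idPr Hp) (minn_idPr (ltnW Hp)).
  by rewrite -leqNgt => Hp; rewrite (minn_idPl Hp) (minn_idPl (leqW Hp)) Rplus_0_r.
apply: is_series_unique; apply: (filterlim_ext_loc (fun=> psum f n));
  last exact: filterlim_const.
by exists n => m /leP nm; rewrite H (minn_idPl (leqW nm)).
Qed.

(** Comparison with the telescoping series of [2 (1/x - 1/(x+1))], since [x + 1 <= 2 x] for
    [x >= 1]. *)
Lemma ex_series_inv_sqr : ex_series (fun k => / INR k.+1 ^ 2).
Proof.
apply: (@ex_series_le _ R_CompleteNormedModule _ (fun k => 2 * (/ INR k.+1 - / INR k.+2))).
  move=> k; rewrite -[norm _]/(Rabs _) Rabs_pos_eq.
    rewrite (S_INR k.+1); have : 0 < INR k.+1 by apply: lt_0_INR; lia.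
    have : 1 <= INR k.+1 by rewrite S_INR; have := pos_INR k; lra.
    move: (INR k.+1) => x x1 x0.
    have -> : 2 * (/ x - / (x + 1)) = / x ^ 2 * (2 * x / (x + 1)) by field; lra.
    rewrite -[X in X <= _]Rmult_1_r; apply: Rmult_le_compat_l.
      by apply/Rlt_le/Rinv_0_lt_compat/pow_lt.
    by apply: (Rmult_le_reg_r (x + 1)); [lra|rewrite /Rdiv Rmult_assoc Rinv_l; lra].
  by apply/Rlt_le/Rinv_0_lt_compat/pow_lt/lt_0_INR; lia.
exists (2 * (1 - 0)).
apply: (is_series_scal_l 2 (fun k => / INR k.+1 - / INR k.+2)).
change (is_lim_seq (sum_n (fun k => / INR k.+1 - / INR k.+2)) (1 - 0)).
apply: (is_lim_seq_ext (fun n => 1 - / INR n.+2)).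
  elim=> [|n IH]; first by rewrite sum_O /=; field.
  by rewrite sum_nS -IH; ring.
apply: is_lim_seq_minus'; first exact: is_lim_seq_const.
apply: (is_lim_seq_ext (fun n => / INR (n + 2))); first by move=> n; rewrite addn2.
apply/(is_lim_seq_incr_n (fun n => / INR n) 2).
exact: (is_lim_seq_inv _ _ is_lim_seq_INR).
Qed.

Lemma Series_tail (u : nat -> R) N : ex_series u ->
  Series (fun k => u (N.+1 + k)%N) = Series u - sum_n u N.
Proof.
move=> exu; have N0 : (0 < N.+1)%coq_nat by lia.
have := Series_incr_n u N.+1 N0 exu; rewrite -sum_n_Reals => ->.
by rewrite /Rminus Rplus_comm -Rplus_assoc Rplus_opp_l Rplus_0_l.
Qed.

(** Dominated convergence for series: beyond some [N] the tails of [a n] and [b] are below [eps / 3]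
    because that of [M] is, and the finite parts converge termwise. *)
Lemma tannery (a : nat -> nat -> R) (b M : nat -> R) :
  (forall n k, Rabs (a n k) <= M k) -> ex_series M ->
  (forall k, is_lim_seq (fun n => a n k) (b k)) ->
  is_lim_seq (fun n => Series (a n)) (Series b).
Proof.
move=> aM exM lim_a.
have bM k : Rabs (b k) <= M k.
  have := is_lim_seq_le (fun n => Rabs (a n k)) (fun=> M k) _ _ (aM^~ k).
  move=> /(_ _ (M k)) H; apply: (H (Finite (Rabs (b k)))); last exact: is_lim_seq_const.
  exact: (is_lim_seq_abs _ (b k)).
have exa n : ex_series (a n) by apply: (@ex_series_le _ R_CompleteNormedModule _ M).
have exb : ex_series b by apply: (@ex_series_le _ R_CompleteNormedModule _ M).
apply/is_lim_seq_spec => eps.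
have e3 : 0 < eps / 3 by have := cond_pos eps; lra.
have [N HN] : exists N, Series (fun k => M (N.+1 + k)%N) < eps / 3.
  have /is_lim_seq_spec Mlim : is_lim_seq (sum_n M) (Series M) by exact: Series_correct.
  have [N HN] := Mlim (mkposreal _ e3).
  exists N; have := HN N (le_n N); rewrite Series_tail //= => H.
  by have := Rle_abs (- (sum_n M N - Series M)); rewrite Rabs_Ropp; lra.
have tail u : (forall k, Rabs (u k) <= M k) -> Rabs (Series u - sum_n u N) < eps / 3.
  move=> uM; have exu : ex_series u by apply: (@ex_series_le _ R_CompleteNormedModule _ M).
  rewrite -Series_tail //.
  apply: Rle_lt_trans HN; have exM' : ex_series (fun k => M (N.+1
    + k)%N) by exact: (proj1 (ex_series_incr_n M N.+1) exM).
  apply: Rle_trans (Series_Rabs _ _) _.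
    apply: (@ex_series_le _ R_CompleteNormedModule _ (fun k => M (N.+1 + k)%N)) => // k.
    by rewrite -[norm _]/(Rabs _) Rabs_Rabsolu.
  by apply: Series_le => // k; split; [apply: Rabs_pos|].
have : is_lim_seq (fun n => sum_n (a n) N) (sum_n b N).
  elim: N {HN tail} => [|N IH].
    by rewrite sum_O; apply: is_lim_seq_ext (lim_a 0%N) => n; rewrite sum_O.
  rewrite sum_nS; apply: (is_lim_seq_ext (fun n => sum_n (a n) N + a n N.+1)).
    by move=> n; rewrite sum_nS.
  exact: is_lim_seq_plus'.
move=> /is_lim_seq_spec Slim; have [n0 Hn] := Slim (mkposreal _ e3).
exists n0 => n /Hn /= H; have := tail _ (aM n); have := tail _ bM.
by split_Rabs; lra.
Qed.

(* [csch2_part (sinh u ^ 2) (sin v ^ 2)] is the real part of [1 / sinh (u + iv) ^ 2]. *)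
Definition csch2_part (a b : R) : R := (a * (1 - b) - (1 + a) * b) / (a + b) ^ 2.

Definition csch2 (u v : R) : R := csch2_part (sinh u ^ 2) (sin v ^ 2).

Lemma sinh_double x : sinh (2 * x) = 2 * sinh x * cosh x.
Proof.
rewrite /sinh /cosh (_ : 2 * x = x + x); last by ring.
by rewrite Ropp_plus_distr !exp_plus; field.
Qed.

(** * Duplication formula of [1 / sinh^2] and its limit *)

(** For [w = z/2], [1 / sinh^2 z = (1 / sinh^2 w + 1 / sinh^2 (w + i pi/2)) / 4], because
    [sinh (w + i pi/2) = i cosh w]. Only [sin^2] of the angle matters, so [(v + PI) / 2] may be
    reflected to [(PI - v) / 2]. *)
Lemma csch2_halve u v : sin v <> 0 ->
  csch2 u v = / 4 * (csch2 (u / 2) (v / 2) + csch2 (u / 2) ((PI - v) / 2)).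
Proof.
rewrite /csch2 -{1 2}(_ : 2 * (v / 2) = v); last by field.
rewrite -{1}(_ : 2 * (u / 2) = u); last by field.
rewrite (_ : (PI - v) / 2 = PI / 2 - v / 2); last by field.
rewrite sin_shift sin_2a sinh_double => v0.
have := sin2_cos2 (v / 2); rewrite /Rsqr => sc.
have C0 : cos (v / 2) <> 0 by move=> E; rewrite E in v0; lra.
have S0 : sin (v / 2) <> 0 by move=> E; rewrite E in v0; lra.
have -> : cos (v / 2) ^ 2 = 1 - sin (v / 2) ^ 2 by rewrite /=; lra.
have -> : (2 * sin (v / 2) * cos (v / 2)) ^ 2 = 4 * sin (v / 2) ^ 2 * (1 - sin (v / 2) ^ 2).
  by rewrite (_ : 1 - sin (v / 2) ^ 2 = cos (v / 2) ^ 2); [ring|rewrite /=; lra].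
have -> : (2 * sinh (u / 2) * cosh (u / 2)) ^ 2
  = 4 * sinh (u / 2) ^ 2 * (1 + sinh (u / 2) ^ 2).
  by rewrite -cosh2_sinh2; ring.
have a0 := pow2_ge_0 (sinh (u / 2)).
have b0 := pow2_gt_0 _ S0.
have b1 : sin (v / 2) ^ 2 < 1 by have := pow2_gt_0 _ C0; rewrite /=; lra.
move: (sinh _ ^ 2) (sin _ ^ 2) a0 b0 b1 => a b a0 b0 b1.
rewrite /csch2_part; field; split; nra.
Qed.

Definition theta (k : nat) : R := (2 * INR k + 1) * (PI / 2).

Lemma theta_bound k m : (k < 2 ^ m)%N -> 0 < theta k / 2 ^ m.+1 < PI / 2.
Proof.
move=> km; have p0 := PI_RGT_0.
have q0 : 0 < 2 ^ m by apply: pow_lt; lra.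
have kr : INR k + 1 <= 2 ^ m.
  rewrite -S_INR (_ : 2 ^ m = INR (2 ^ m)); last first.
    by elim: m {km q0} => // m IH; rewrite expnS INR_muln -IH.
  by apply: le_INR; lia.
have k0 := pos_INR k; rewrite /theta; split.
  apply: Rdiv_lt_0_compat; last by rewrite /=; lra.
  by apply: Rmult_lt_0_compat; lra.
apply: (Rmult_lt_reg_r (2 ^ m.+1)); first by rewrite /=; lra.
rewrite /Rdiv Rmult_assoc Rinv_l; last by rewrite /=; lra.
by rewrite /=; nra.
Qed.

(** Halving the angle [theta k / 2^(m+1)] yields those of index [k] and [2^(m+1) - 1 - k] at the
    next level: the first half of the new range, and the second half read backwards. The leading 2
    arises in the first step, where both angles are [PI / 4]. *)
Lemma csch2_PI2 y m : csch2 y (PI / 2) =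
  2 * (/ 4 ^ m.+1 * psum (fun k => csch2 (y / 2 ^ m.+1) (theta k / 2 ^ m.+1)) (2 ^ m)).
Proof.
elim: m => [|m IH].
  rewrite csch2_halve; last by rewrite sin_PI2; lra.
  rewrite /= /theta /= (_ : (PI - PI / 2) / 2 = PI / 2 / 2); last by field.
  rewrite !Rmult_1_r Rmult_0_r !Rplus_0_l Rmult_1_l; field.
rewrite IH expnS mul2n -addnn psum_cat -(psum_rev (fun i => csch2 _ (theta (2 ^ m
  + i)%N / _))) -psumD.
rewrite -(_ : / 4 ^ m.+1 * / 4 = / 4 ^ m.+2); last first.
  by rewrite -Rinv_mult Rmult_comm.
rewrite (Rmult_assoc (/ 4 ^ m.+1)) -[in RHS]psumZ; congr (_ * (_ * _)); apply: eq_psum => k km.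
have [t0 t1] := theta_bound _ _ km.
have q0 : 2 ^ m <> 0 by apply: pow_nonzero; lra.
rewrite csch2_halve; last by apply/Rgt_not_eq/sin_gt_0; have := PI_RGT_0; lra.
congr (_ * (csch2 _ _ + csch2 _ _)); [by rewrite /=; field|by rewrite /=;
  field|by rewrite /=; field|].
rewrite /theta -[2 ^ m.+2]/(2 * (2 * 2 ^ m)) -[2 ^ m.+1]/(2 * 2 ^ m).
have -> : INR (2 ^ m + (2 ^ m - k.+1)) = 2 * 2 ^ m - INR k - 1.
  have <- : INR (2 ^ m) = 2 ^ m by elim: m {IH km t0 t1 q0} => // m IH;
    rewrite expnS INR_muln IH.
  rewrite INR_addn minus_INR; last by lia.
  by rewrite S_INR; ring.
by field.
Qed.

Lemma csch2_PI2_cosh y : csch2 y (PI / 2) = - / cosh y ^ 2.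
Proof.
rewrite /csch2 sin_PI2 cosh2_sinh2 /csch2_part; have := pow2_ge_0 (sinh y).
move: (sinh y ^ 2) => a a0; field; lra.
Qed.

(** The numerator lies between [-(a+b)] and [a+b]. The resulting bound is uniform in [a], as
    dominated convergence requires. *)
Lemma csch2_part_le a b : 0 <= a -> 0 < b <= 1 -> Rabs (csch2_part a b) <= / b.
Proof.
move=> a0 [b0 b1]; apply: (Rle_trans _ (/ (a + b))); last by apply: Rinv_le_contravar; lra.
have -> : / (a + b) = (a + b) / (a + b) ^ 2 by field; lra.
have q0 : 0 < / (a + b) ^ 2 by apply/Rinv_0_lt_compat/pow_lt; lra.
rewrite /csch2_part /Rdiv Rabs_mult (Rabs_pos_eq (/ _)); last by lra.
apply: Rmult_le_compat_r; first by lra.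
apply: Rabs_le; nra.
Qed.

(** From [sin v >= v - v^3 / 6] and [v <= 2]. *)
Lemma sin_ge_third v : 0 <= v <= PI / 2 -> v / 3 <= sin v.
Proof.
move=> [v0 v1]; have p4 := PI_4.
have [+ _] := pre_sin_bound v 0 v0 ltac:(lra).
rewrite /sin_approx /= /sin_term /=; nra.
Qed.

Lemma is_lim_seq_inv_pow2 : is_lim_seq (fun m => / 2 ^ m.+1) 0.
Proof.
apply: (is_lim_seq_ext (fun m => (/ 2) ^ (m + 1))).
  by move=> m; rewrite pow_inv addn1.
apply/(is_lim_seq_incr_n (fun m => (/ 2) ^ m) 1); apply: is_lim_seq_geom.
by rewrite Rabs_pos_eq; lra.
Qed.

Lemma is_lim_seq_rescale (f : R -> R) y : f 0 = 0 -> is_derive f 0 1 ->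
  is_lim_seq (fun m => f (y / 2 ^ m.+1) * 2 ^ m.+1) y.
Proof.
move=> f0 /is_derive_Reals df; have q m : 2 ^ m.+1 <> 0 by apply: pow_nonzero; lra.
case: (Req_dec y 0) => [->|y0].
  apply: (is_lim_seq_ext (fun=> 0)); last exact: is_lim_seq_const.
  by move=> m; rewrite /Rdiv Rmult_0_l f0; ring.
have hy m : y / 2 ^ m.+1 <> 0 by apply: Rmult_integral_contrapositive_currified;
  [|apply: Rinv_neq_0_compat].
apply: (is_lim_seq_ext (fun m => y * (f (y / 2 ^ m.+1) / (y / 2 ^ m.+1)))).
  by move=> m; field; split.
rewrite (_ : Finite y = Finite (y * 1)); last by rewrite Rmult_1_r.
apply: is_lim_seq_mult'; first exact: is_lim_seq_const.
apply/is_lim_seq_spec => eps; have [d Hd] := df eps (cond_pos eps).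
have /is_lim_seq_spec L : is_lim_seq (fun m => y * / 2 ^ m.+1) 0.
  by rewrite -(Rmult_0_r y); apply: is_lim_seq_mult';
    [exact: is_lim_seq_const|exact: is_lim_seq_inv_pow2].
have [N HN] := L d; exists N => m /HN; rewrite Rminus_0_r => H.
by have := Hd _ (hy m) H; rewrite Rplus_0_l f0 Rminus_0_r.
Qed.

Lemma pow4_pow2 m : 4 ^ m = (2 ^ m) ^ 2.
Proof. by elim: m => [|m IH]; [|rewrite /= in IH *; rewrite IH]; rewrite /=; ring. Qed.

(** The limit is the real part of [1 / (y + it)^2]. After rescaling, [A] tends to [y^2] and [B] to
    [t^2], while the products of the two squares carry the factor [e], which tends to 0. *)
Lemma csch2_rescale_lim y t : t <> 0 ->
  is_lim_seq (fun m => / 4 ^ m.+1 * csch2 (y / 2 ^ m.+1) (t / 2 ^ m.+1))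
    ((y ^ 2 - t ^ 2) / (y ^ 2 + t ^ 2) ^ 2).
Proof.
move=> t0.
pose A m := (sinh (y / 2 ^ m.+1) * 2 ^ m.+1) ^ 2.
pose B m := (sin (t / 2 ^ m.+1) * 2 ^ m.+1) ^ 2.
pose e m := (/ 2 ^ m.+1) ^ 2.
have q m : 2 ^ m.+1 <> 0 by apply: pow_nonzero; lra.
have lsq u l : is_lim_seq u (Finite l) -> is_lim_seq (fun m => u m ^ 2) (l ^ 2).
  move=> H; apply: (is_lim_seq_ext (fun m => u m * u m)); first by move=> m /=; ring.
  by rewrite (_ : l ^ 2 = l * l); [exact: is_lim_seq_mult'|ring].
have LA : is_lim_seq A (y ^ 2).
  apply/lsq/is_lim_seq_rescale; first exact: sinh_0.
  by rewrite -cosh_0; exact: is_derive_sinh.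
have LB : is_lim_seq B (t ^ 2).
  apply/lsq/is_lim_seq_rescale; first exact: sin_0.
  by apply/is_derive_Reals; rewrite -cos_0; exact: derivable_pt_lim_sin.
have Le : is_lim_seq e 0.
  by rewrite -(_ : 0 ^ 2 = 0); [exact/lsq/is_lim_seq_inv_pow2|ring].
apply: (is_lim_seq_ext (fun m => (A m * (1 - B m * e m) - (1 + A m * e m) * B m) / (A m
  + B m) ^ 2)).
  move=> m; rewrite /csch2 /csch2_part.
  rewrite pow4_pow2.
  have -> : sinh (y / 2 ^ m.+1) ^ 2 = A m * e m by rewrite /A /e; field.
  have -> : sin (t / 2 ^ m.+1) ^ 2 = B m * e m by rewrite /B /e; field.
  rewrite /e; move: (2 ^ m.+1) (q m) (A m) (B m) => r r0 a b.
  rewrite (_ : (a * (/ r) ^ 2 + b * (/ r) ^ 2) ^ 2 = (a + b) ^ 2 * (/ r) ^ 4); last by ring.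
  by rewrite /Rdiv Rinv_mult; move: (/ (a + b) ^ 2) => i; field.
rewrite (_ : y ^ 2 - t ^ 2 = y ^ 2 * (1 - t ^ 2 * 0) - (1 + y ^ 2 * 0) * t ^ 2); last by ring.
apply: is_lim_seq_div'; last first.
- apply: pow_nonzero; have := pow2_gt_0 t t0; have := pow2_ge_0 y; lra.
- by apply/lsq/is_lim_seq_plus'.
apply: is_lim_seq_minus'; apply: is_lim_seq_mult' => //.
  by apply: is_lim_seq_minus'; [exact: is_lim_seq_const|exact: is_lim_seq_mult'].
by apply: is_lim_seq_plus'; [exact: is_lim_seq_const|exact: is_lim_seq_mult'].
Qed.

Lemma theta_ge k : INR k.+1 <= theta k.
Proof.
rewrite /theta S_INR; have := pos_INR k; have := PI2_1; move: (PI / 2) (INR k) => p x; nra.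
Qed.

Lemma theta_gt0 k : 0 < theta k.
Proof. by have := theta_ge k; have : 0 < INR k.+1 by [apply: lt_0_INR; lia]; lra. Qed.

Lemma sech2_series y :
  2 * Series (fun k => (y ^ 2 - theta k ^ 2) / (y ^ 2 + theta k ^ 2) ^ 2) = - / cosh y ^ 2.
Proof.
pose a m k := if (k < 2 ^ m)%N then / 4 ^ m.+1 * csch2 (y / 2 ^ m.+1) (theta k / 2 ^ m.+1)
  else 0.
have Ea m : Series (a m) = - / cosh y ^ 2 / 2.
  rewrite /a Series_psum psumZ -csch2_PI2_cosh (csch2_PI2 y m); field.
  by apply: pow_nonzero; lra.
have L : is_lim_seq (fun m => Series (a m)) (Series (fun k
  => (y ^ 2 - theta k ^ 2) / (y ^ 2 + theta k ^ 2) ^ 2)).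
  (* The majorant comes from [sin v >= v / 3] and [theta k >= k + 1]; the powers of 2 cancel against
     [4^(m+1)]. *)
  apply: (tannery _ _ (fun k => 9 * / INR k.+1 ^ 2)).
  - move=> m k; rewrite /a; have k0 : 0 < INR k.+1 by apply: lt_0_INR; lia.
    have i0 : 0 < / INR k.+1 ^ 2 by apply/Rinv_0_lt_compat/pow_lt.
    case: ifP => km; last by rewrite Rabs_R0; lra.
    have [t0 t1] := theta_bound _ _ km.
    have s3 := sin_ge_third (theta k / 2 ^ m.+1) ltac:(lra).
    have q : 0 < 2 ^ m.+1 by apply: pow_lt; lra.
    have q4 : 0 < 4 ^ m.+1 by apply: pow_lt; lra.
    rewrite Rabs_mult Rabs_pos_eq; last by apply/Rlt_le/Rinv_0_lt_compat.
    have sv : 0 < sin (theta k / 2 ^ m.+1) by lra.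
    apply: (Rle_trans _ (/ 4 ^ m.+1 * / sin (theta k / 2 ^ m.+1) ^ 2)).
      apply: Rmult_le_compat_l; first by apply/Rlt_le/Rinv_0_lt_compat.
      apply: csch2_part_le; first exact: pow2_ge_0.
      split; first exact: pow_lt.
      have := SIN_bound (theta k / 2 ^ m.+1); rewrite /=; nra.
    rewrite -Rinv_mult -[9]Rinv_inv -Rinv_mult; apply: Rinv_le_contravar.
      by apply: Rmult_lt_0_compat; [lra|exact: pow_lt].
    rewrite pow4_pow2 -Rpow_mult_distr (_ : / 9 * _ = (INR k.+1 / 3) ^ 2); last by field.
    apply: pow_incr; split; first by lra.
    have := theta_ge k; have E : 2 ^ m.+1 * (theta k / 2 ^ m.+1 / 3) = theta k / 3 by field;
      lra.
    have := Rmult_le_compat_l _ _ _ (Rlt_le _ _ q) s3; lra.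
  - exact: (ex_series_scal_l 9 _ ex_series_inv_sqr).
  - move=> k; apply: is_lim_seq_ext_loc (csch2_rescale_lim y (theta k) _);
    last by have := theta_gt0 k; lra.
    exists k => m km; rewrite /a (_ : (k < 2 ^ m)%N) //.
    by apply: leq_ltn_trans (ltn_expl m _); lia.
have := is_lim_seq_ext _ (fun=> - / cosh y ^ 2 / 2) _ Ea L.
move=> /is_lim_seq_unique; rewrite Lim_seq_const => -[<-]; field; have := cosh_gt0 y; lra.
Qed.

(** * Termwise differentiation *)

Lemma Im_le_Cmod (z : C) : Rabs (Im z) <= Cmod z.
Proof. exact: Rle_trans (Rmax_r _ _) (Rmax_Cmod z). Qed.

(** First-order Taylor estimate for [z^(-p)], with [A = 1/z] and [B = 1/(z+h)]. The induction step
    adds [p + 1] error terms to [p^2], and [p^2 + p + 1 <= (p+1)^2]. *)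
Lemma inv_pow_taylor (A B : C) (h r : R) (p : nat) :
  Cmod A <= r -> Cmod B <= r -> (B - A = - (h * A * B))%C ->
  Cmod (B ^ p - A ^ p + INR p * h * A ^ p.+1)%C <= INR p ^ 2 * h ^ 2 * r ^ p.+2.
Proof.
move=> Ar Br E.
have A0 := Cmod_ge_0 A; have B0 := Cmod_ge_0 B.
have r0 : 0 <= r by lra.
have An n : Cmod (A ^ n) <= r ^ n by rewrite Cmod_pow; apply: pow_incr.
have absh : Rabs h * Rabs h = h ^ 2 by rewrite -Rabs_mult Rabs_pos_eq /=; nra.
elim: p => [|p IH].
  rewrite (_ : (_ + _)%C = 0%C); last by rewrite /=; ring.
  by rewrite Cmod_0 /=; nra.
have -> : (B ^ p.+1 - A ^ p.+1 + INR p.+1 * h * A ^ p.+2 =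
   B * (B ^ p - A ^ p + INR p * h * A ^ p.+1) + (A ^ p.+2 * (h * h) * B
     + INR p * A ^ p.+2 * (h * h) * B))%C.
  have E2 : (B = A - h * A * B)%C by rewrite /Cminus -E; ring.
  have -> : (A ^ p.+2 * (h * h) * B + INR p * A ^ p.+2 * (h * h) * B
    = - (A ^ p.+1 * h * (B - A)) - INR p * A ^ p.+1 * h * (B - A))%C.
    by rewrite E /=; ring.
  rewrite S_INR RtoC_plus.
  have -> : (- (A ^ p.+1 * h * (B - A)) = A ^ p * (B - A) + h * A ^ p.+2)%C.
    transitivity (A ^ p * (- (h * A * B) + h * A * A))%C; first by rewrite /=; ring.
    by rewrite -E /=; ring.
  by rewrite /=; ring.
have bound (c : R) : 0 <= c -> Cmod (c * A ^ p.+2 * (h * h) * B)%C <= c * h ^ 2 * r ^ p.+3.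
  move=> c0; rewrite (Cmod_mult (c * A ^ p.+2 * (h * h))) (Cmod_mult (c * A ^ p.+2))
    (Cmod_mult c) (Cmod_mult h) !Cmod_R absh (Rabs_pos_eq c) //.
  rewrite (_ : c * h ^ 2 * r ^ p.+3 = (c * h ^ 2) * (r ^ p.+2 * r)); last by rewrite /=; ring.
  rewrite (_ : c * Cmod (A ^ p.+2) * h ^ 2 * Cmod B
    = (c * h ^ 2) * (Cmod (A ^ p.+2) * Cmod B)); last by ring.
  apply: Rmult_le_compat_l; first by have := pow2_ge_0 h; nra.
  by apply: Rmult_le_compat => //; exact: Cmod_ge_0.
apply: Rle_trans (Cmod_triangle _ _) _.
apply: Rle_trans (Rplus_le_compat_l _ _ _ (Cmod_triangle _ _)) _.
have b1 := bound 1 Rle_0_1; have bp := bound (INR p) (pos_INR p).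
rewrite Cmult_1_l in b1.
have b3 : Cmod (B * (B ^ p - A ^ p + INR p * h * A ^ p.+1))%C <= r * (INR p ^ 2 * h ^ 2 * r ^
  p.+2).
  by rewrite Cmod_mult; apply: Rmult_le_compat => //; exact: Cmod_ge_0.
apply: Rle_trans (Rplus_le_compat _ _ _ _ b3 (Rplus_le_compat _ _ _ _ b1 bp)) _.
rewrite S_INR.
have p0 := pos_INR p.
have : 0 <= INR p * h ^ 2 * r ^ p.+3.
  by apply: Rmult_le_pos; [have := pow2_ge_0 h; nra|exact: pow_le].
by rewrite -[r ^ p.+3]/(r * r ^ p.+2); nra.
Qed.

(** * The sums [E_p] as functions of a real variable *)

Definition inv_line (x c : R) : C := (/ (x, c))%C.

Lemma pair_neq0 (x c : R) : c <> 0 -> (x, c) <> RtoC 0.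
Proof. by move=> c0 [_ E]. Qed.

Lemma Cmod_inv_line x c : c <> 0 -> Cmod (inv_line x c) <= / Rabs c.
Proof.
move=> c0; rewrite /inv_line Cmod_inv; last exact: pair_neq0.
apply: Rinv_le_contravar; first exact: Rabs_pos_lt.
exact: (Im_le_Cmod (x, c)).
Qed.

Lemma inv_line_diff x h c : c <> 0 ->
  (inv_line (x + h) c - inv_line x c = - (h * inv_line x c * inv_line (x + h) c))%C.
Proof.
move=> c0; rewrite /inv_line.
have n1 := pair_neq0 x c c0; have n2 := pair_neq0 (x + h) c c0.
have E : (x + h, c) = ((x, c) + RtoC h)%C by rewrite /Cplus /= Rplus_0_r.
rewrite E in n2 *; move: (x, c) n1 n2 => u n1 n2; field; by split.
Qed.

(** A remainder bounded by [K h^2] for every [h] can be summed over [n], which justifies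
    differentiation under the series sign. *)
Lemma is_derive_quadratic (f : R -> R) x l K :
  (forall h, Rabs (f (x + h) - f x - h * l) <= K * h ^ 2) -> is_derive f x l.
Proof.
move=> H; apply/is_derive_Reals => eps e0.
have K0 : 0 <= K by have := Rle_trans _ _ _ (Rabs_pos _) (H 1); lra.
have d0 : 0 < eps / (K + 1) by apply: Rdiv_lt_0_compat; lra.
exists (mkposreal _ d0) => h h0 /= hd.
rewrite (_ : _ - l = (f (x + h) - f x - h * l) / h); last by field.
have ah := Rabs_pos_lt _ h0.
rewrite Rabs_div //; apply: (Rmult_lt_reg_r (Rabs h)) => //.
rewrite /Rdiv Rmult_assoc Rinv_l ?Rmult_1_r; last by lra.
apply: Rle_lt_trans (H h) _; rewrite -(pow2_abs h) /= Rmult_1_r -Rmult_assoc.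
apply: Rmult_lt_compat_r => //.
have E : eps = (K + 1) * (eps / (K + 1)) by field; lra.
by rewrite E; nra.
Qed.

Lemma inv_line_theta_le x n : Cmod (inv_line x (theta n)) <= / INR n.+1.
Proof.
have t0 := theta_gt0 n.
apply: Rle_trans (Cmod_inv_line _ _ _) _; first by lra.
rewrite Rabs_pos_eq; last by lra.
by apply: Rinv_le_contravar (theta_ge n); apply: lt_0_INR; lia.
Qed.

Lemma pow_inv_INR_le n p : (/ INR n.+1) ^ p.+2 <= / INR n.+1 ^ 2.
Proof.
have n1 : 1 <= INR n.+1 by rewrite S_INR; have := pos_INR n; lra.
rewrite -pow_inv; have i0 : 0 < / INR n.+1 by apply: Rinv_0_lt_compat; lra.
have i1 : / INR n.+1 <= 1 by rewrite -Rinv_1; apply: Rinv_le_contravar; lra.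
rewrite (_ : p.+2 = 2 + p)%N // pow_add -[X in _ <= X]Rmult_1_r.
apply: Rmult_le_compat_l; first exact: pow2_ge_0.
by rewrite -(pow1 p); apply: pow_incr; lra.
Qed.

Lemma inv_line_pow_le x n p : Cmod (inv_line x (theta n) ^ p.+2)%C <= / INR n.+1 ^ 2.
Proof.
apply: Rle_trans (pow_inv_INR_le n p); rewrite Cmod_pow; apply: pow_incr; split.
  exact: Cmod_ge_0.
exact: inv_line_theta_le.
Qed.

Lemma ex_series_dom (u M : nat -> R) :
  (forall n, Rabs (u n) <= M n) -> ex_series M -> ex_series u.
Proof. exact: (@ex_series_le _ R_CompleteNormedModule). Qed.

Lemma Rabs_Series_le (u M : nat -> R) :
  (forall n, Rabs (u n) <= M n) -> ex_series M -> Rabs (Series u) <= Series M.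
Proof.
move=> uM exM; apply: Rle_trans (Series_Rabs _ _) _.
  by apply: (ex_series_dom _ M) => // n; rewrite Rabs_Rabsolu.
by apply: Series_le => // n; split; [apply: Rabs_pos|].
Qed.

(** Half of [E_p]: the conjugate terms, belonging to negative indices, supply the factor 2. *)
Definition eis (p : nat) (y : R) : R := Series (fun n => Re (inv_line y (theta n) ^ p)%C).

Lemma ex_eis p y : ex_series (fun n => Re (inv_line y (theta n) ^ p.+2)%C).
Proof.
apply: ex_series_dom ex_series_inv_sqr => n.
exact: Rle_trans (re_le_Cmod _) (inv_line_pow_le _ _ _).
Qed.

Lemma is_derive_eis p x : is_derive (eis p.+2) x (- INR p.+2 * eis p.+3 x).
Proof.
(* The constant sums the Taylor remainders with [r = 1/(n+1)], the power [r^(p+4)] being at most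
   [r^2]. *)
apply: (@is_derive_quadratic _ _ _ (Series (fun n => INR p.+2 ^ 2 * / INR n.+1 ^ 2))) => h.
have -> : eis p.+2 (x + h) - eis p.+2 x - h * (- INR p.+2 * eis p.+3 x) =
  Series (fun n => Re (inv_line (x + h) (theta n) ^ p.+2 - inv_line x (theta n) ^ p.+2
     + INR p.+2 * h * inv_line x (theta n) ^ p.+3)%C).
  rewrite (@Series_ext _ (fun n => Re (inv_line (x
    + h) (theta n) ^ p.+2)%C - Re (inv_line x (theta n) ^ p.+2)%C
     + INR p.+2 * h * Re (inv_line x (theta n) ^ p.+3)%C)); last first.
    move=> n; move: (_ ^ p.+2)%C (_ ^ p.+2)%C (_ ^ p.+3)%C => [a a'] [b b'] [c c'] /=; ring.
  rewrite Series_plus.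
  - rewrite Series_minus; [|exact: ex_eis|exact: ex_eis].
    by rewrite Series_scal_l /eis; ring.
  - by apply: (@ex_series_minus _ R_NormedModule); exact: ex_eis.
  - exact: (ex_series_scal_l (INR p.+2 * h) _ (ex_eis p.+1 x)).
rewrite Rmult_comm -Series_scal_l; apply: Rabs_Series_le.
  move=> n; apply: Rle_trans (re_le_Cmod _) _.
  apply: Rle_trans (inv_pow_taylor _ _ h (/ INR n.+1) p.+2 _ _ _) _.
  - exact: inv_line_theta_le.
  - exact: inv_line_theta_le.
  - by apply: inv_line_diff; have := theta_gt0 n; lra.
  have := pow_inv_INR_le n p.+2; have := pow2_ge_0 h; have := pow2_ge_0 (INR p.+2).
  move: (INR p.+2 ^ 2) (h ^ 2) ((/ INR n.+1) ^ p.+4) (/ INR n.+1 ^ 2) => a b c d a0 b0 cd.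
  have ab : 0 <= a * b by apply: Rmult_le_pos.
  by have := Rmult_le_compat_l _ _ _ ab cd; lra.
apply: (ex_series_scal_l (h ^ 2) (fun n => INR p.+2 ^ 2 * / INR n.+1 ^ 2)).
exact: (ex_series_scal_l (INR p.+2 ^ 2) _ ex_series_inv_sqr).
Qed.

Lemma eis2 y : 2 * eis 2 y = - tanh_deriv 1 y.
Proof.
rewrite tanh_deriv1 -sech2_series; congr (_ * _); apply: Series_ext => n.
have t0 := theta_gt0 n; have q0 : y ^ 2 + theta n ^ 2 <> 0 by nra.
by rewrite /inv_line /Cinv /=; field; rewrite /= in q0; lra.
Qed.

(** Both sides of the identity at [n] are differentiated in [y]; uniqueness of the derivative and
    division by [-(n+2)] give the next one. *)
Lemma eisE n y : 2 * eis n.+2 y = (-1) ^ n.+1 / INR (n.+1)`! * tanh_deriv n.+1 y.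
Proof.
elim: n y => [|n IH] y; first by rewrite eis2 factS fact0 /=; field.
have F0 m : INR m`! <> 0 by apply: not_0_INR; have := fact_gt0 m; lia.
have D1 : is_derive (fun y => 2 * eis n.+2 y) y (2 * (- INR n.+2 * eis n.+3 y)).
  exact/is_derive_scal/is_derive_eis.
have D2 : is_derive (fun y => 2 * eis n.+2 y) y ((-1) ^ n.+1 / INR (n.+1)`! * tanh_deriv n.+2
  y).
  apply: (is_derive_ext (fun y => (-1) ^ n.+1 / INR (n.+1)`! * tanh_deriv n.+1 y)).
    by move=> z; rewrite IH.
  exact/is_derive_scal/is_derive_tanh_deriv.
have E := etrans (esym (is_derive_unique _ _ _ D1)) (is_derive_unique _ _ _ D2).
have n0 : INR n.+2 <> 0 by apply: not_0_INR.
apply: (Rmult_eq_reg_l (- INR n.+2)); last by lra.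
rewrite (_ : - INR n.+2 * (2 * eis n.+3 y) = 2 * (- INR n.+2 * eis n.+3 y)); last by ring.
rewrite E (factS n.+1) INR_muln -[(-1) ^ n.+2]/(-1 * (-1) ^ n.+1).
by field; split.
Qed.

(** * Complex series *)

Local Notation Csum := (@sum_n C_AbelianMonoid).

Lemma Csum_O (u : nat -> C) : Csum u 0 = u 0%N.
Proof. exact: sum_O. Qed.

Lemma Csum_S (u : nat -> C) n : Csum u n.+1 = (Csum u n + u n.+1)%C.
Proof. exact: sum_Sn. Qed.

Lemma eq_Csum (u v : nat -> C) n :
  (forall i, (i <= n)%N -> u i = v i) -> Csum u n = Csum v n.
Proof. by move=> E; apply: sum_n_ext_loc => i Hi; apply: E; lia. Qed.

Lemma CsumE (u : nat -> C) n :
  Csum u n = (sum_n (fun i => Re (u i)) n, sum_n (fun i => Im (u i)) n).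
Proof.
elim: n => [|n IH]; first by rewrite Csum_O !sum_O; case: (u 0%N).
by rewrite Csum_S !sum_nS IH.
Qed.

Lemma CseriesE (u : nat -> C) (s : C) :
  is_Cseries u s <-> (forall eps : posreal,
    eventually (fun n => Cmod (Csum u n - s)%C < eps)).
Proof.
exact (@filterlim_locally_ball_norm C_AbsRing nat C_NormedModule eventually _ (Csum u) s).
Qed.

Lemma is_Cseries_pair (u : nat -> C) (s : C) :
  is_series (fun n => Re (u n)) (Re s) -> is_series (fun n => Im (u n)) (Im s) ->
  is_Cseries u s.
Proof.
move=> HR HI; apply/CseriesE => eps.
have e2 : 0 < eps / 2 by have := cond_pos eps; lra.
have /is_lim_seq_spec LR : is_lim_seq (sum_n (fun n => Re (u n))) (Re s) by [].
have /is_lim_seq_spec LI : is_lim_seq (sum_n (fun n => Im (u n))) (Im s) by [].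
have [N1 H1] := LR (mkposreal _ e2); have [N2 H2] := LI (mkposreal _ e2).
exists (maxn N1 N2) => n nN; have /= h1 := H1 n ltac:(lia); have /= h2 := H2 n ltac:(lia).
rewrite CsumE; move: h1 h2; case: s {HR HI LR LI H1 H2} => a b /=.
set x := sum_n _ n; set y := sum_n (fun n => snd _) n => h1 h2.
have -> : ((x, y) - (a, b) = RtoC (x - a) + Ci * RtoC (y - b))%C.
  by rewrite /Cminus /Cplus /Cmult /=; congr (_, _); ring.
apply: Rle_lt_trans (Cmod_triangle _ _) _; rewrite Cmod_mult !Cmod_R.
have -> : Cmod Ci = 1 by rewrite /Cmod /= (_ : 0 * _ + _ = 1) ?sqrt_1 //; ring.
lra.
Qed.

Lemma is_Cseries_Re_Im (u : nat -> C) (s : C) : is_Cseries u s ->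
  is_series (fun n => Re (u n)) (Re s) /\ is_series (fun n => Im (u n)) (Im s).
Proof.
move=> /CseriesE H.
have L f : (forall z : C, Rabs (f z) <= Cmod z) -> (forall z w, f (z - w)%C = f z - f w) ->
   (forall n, f (Csum u n) = sum_n (fun i => f (u i)) n) -> is_series (fun n => f (u n)) (f s).
  move=> fC fB fS; change (is_lim_seq (sum_n (fun n => f (u n))) (f s)).
  apply/is_lim_seq_spec => eps; have [N HN] := H eps; exists N => n /HN.
  by rewrite -fS -fB; apply: Rle_lt_trans.
split; apply: L.
- exact: re_le_Cmod.
- by move=> [a b] [c d].
- by move=> n; rewrite CsumE.
- exact: Im_le_Cmod.
- by move=> [a b] [c d].
- by move=> n; rewrite CsumE.
Qed.

Lemma is_Cseries_CSeries (u : nat -> C) (s : C) : is_Cseries u s -> CSeries u = s.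
Proof.
move=> /is_Cseries_Re_Im[HR HI]; rewrite /CSeries (is_series_unique _ _ HR) (is_series_unique
  _ _ HI).
by case: s {HR HI}.
Qed.

Lemma is_Cseries_unique (u : nat -> C) (s1 s2 : C) :
  is_Cseries u s1 -> is_Cseries u s2 -> s1 = s2.
Proof. by move=> /is_Cseries_CSeries <- /is_Cseries_CSeries <-. Qed.

Lemma CSeries_correct (u : nat -> C) : ex_Cseries u -> is_Cseries u (CSeries u).
Proof. by case=> s Hs; rewrite (is_Cseries_CSeries u s Hs). Qed.

Lemma ex_Cseries_dom (u : nat -> C) (M : nat -> R) :
  (forall n, Cmod (u n) <= M n) -> ex_series M -> ex_Cseries u.
Proof.
move=> uM exM; exists (CSeries u); apply: is_Cseries_pair; apply: Series_correct;
  apply: (ex_series_dom _ M) => // n; apply: Rle_trans (uM n).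
  exact: re_le_Cmod.
exact: Im_le_Cmod.
Qed.

Lemma is_Cseries_ext (u v : nat -> C) (s : C) :
  (forall n, u n = v n) -> is_Cseries u s -> is_Cseries v s.
Proof. exact: is_series_ext. Qed.

Lemma is_Cseries_plus (u v : nat -> C) (s t : C) :
  is_Cseries u s -> is_Cseries v t -> is_Cseries (fun n => u n + v n)%C (s + t)%C.
Proof. exact: is_series_plus. Qed.

Lemma is_Cseries_scal (c : C) (u : nat -> C) (s : C) :
  is_Cseries u s -> is_Cseries (fun n => c * u n)%C (c * s)%C.
Proof. exact: (@is_series_scal_l C_AbsRing C_NormedModule). Qed.

Lemma is_Cseries_0 : is_Cseries (fun=> RtoC 0) (RtoC 0).
Proof.
apply/CseriesE => eps; exists 0%N => n _; rewrite (_ : Csum _ n = RtoC 0).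
  by rewrite (_ : (_ - _)%C = RtoC 0) ?Cmod_0; [exact: cond_pos|ring].
by elim: n => [|n IH]; rewrite ?Csum_O ?Csum_S ?IH ?Cplus_0_r.
Qed.

Lemma is_Cseries_sum (u : nat -> nat -> C) (s : nat -> C) k :
  (forall l, is_Cseries (u l) (s l)) ->
  is_Cseries (fun n => Csum (fun l => u l n) k) (Csum s k).
Proof.
move=> H; elim: k => [|k IH].
  by rewrite Csum_O; apply: is_Cseries_ext (H 0%N) => n; rewrite Csum_O.
rewrite Csum_S; apply: is_Cseries_ext (is_Cseries_plus _ _ _ _ IH (H k.+1)) => n.
by rewrite Csum_S.
Qed.

(** * Finite double sums with complex entries *)

Definition Cdsum (c : nat -> nat -> R) (X : nat -> C) (k : nat) : C :=
  Csum (fun j => Csum (fun l => RtoC (c j l) * X l)%C j) k.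

Definition Ccut0 (X : nat -> C) (l : nat) : C := if l is 0 then RtoC 0 else X l.

Lemma CdsumE c X k :
  Cdsum c X k = (dsum c (fun l => Re (X l)) k, dsum c (fun l => Im (X l)) k).
Proof.
rewrite /Cdsum CsumE; congr (_, _); apply: eq_sum_n => j _; rewrite CsumE /=;
  by apply: eq_sum_n => l _; case: (X l) => a b /=; ring.
Qed.

(** Holds for an arbitrary [X 0], hence also for the default value of [CSeries] when the [tanh]
    series diverges. *)
Lemma Cdsum_odd_cut0 k X : (0 < k)%N -> Cdsum (odd_coef k) X k
  = Cdsum (odd_coef k) (Ccut0 X) k.
Proof.
move=> k0; rewrite !CdsumE (dsum_odd_cut0 k (fun l
  => Re (X l))) // (dsum_odd_cut0 k (fun l => Im (X l))) //.
by congr (_, _); apply: eq_dsum => j [|l].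
Qed.

Lemma Cdsum_factor c (z : C) t k : Cdsum c (fun l => z * RtoC (t l))%C k
  = (z * RtoC (dsum c t k))%C.
Proof.
rewrite CdsumE; case: z => a b; rewrite /Cmult /RtoC /=; congr (_, _).
  rewrite (_ : _ - _ = a * dsum c t k); last by ring.
  rewrite /dsum -sum_nZ; apply: eq_sum_n => j _; rewrite -sum_nZ; apply: eq_sum_n => l _ /=;
    ring.
rewrite (_ : _ + _ = b * dsum c t k); last by ring.
rewrite /dsum -sum_nZ; apply: eq_sum_n => j _; rewrite -sum_nZ; apply: eq_sum_n => l _ /=;
  ring.
Qed.

Lemma Csum_from1 (u : nat -> C) n :
  @sum_n_m C_AbelianMonoid u 1 n = Csum (Ccut0 u) n.
Proof.
elim: n => [|n IH]; first by rewrite Csum_O sum_n_m_zero.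
rewrite Csum_S -IH; apply: sum_n_Sm; lia.
Qed.

(** The sums over [1 <= l <= j <= k] gain only zero terms when extended to index 0. *)
Lemma Cdsum_from1 c X k :
  @sum_n_m C_AbelianMonoid (fun j => @sum_n_m C_AbelianMonoid (fun l
    => RtoC (c j l) * X l)%C 1 j) 1 k
  = Cdsum c (Ccut0 X) k.
Proof.
rewrite Csum_from1; apply: eq_Csum => -[|j] _.
  by rewrite Csum_O /= Cmult_0_r.
rewrite /= Csum_from1; apply: eq_Csum => -[|l] _ //=; by rewrite Cmult_0_r.
Qed.

Lemma is_Cseries_Cdsum c (u : nat -> nat -> C) (s : nat -> C) k :
  (forall l, is_Cseries (fun n => u n l) (s l)) ->
  is_Cseries (fun n => Cdsum c (u n) k) (Cdsum c s k).
Proof.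
move=> H; apply: is_Cseries_sum => j; apply: is_Cseries_sum => l.
exact: is_Cseries_scal.
Qed.

(** * Convergence of the outer series *)

Lemma cosh_opp y : cosh (- y) = cosh y.
Proof. by rewrite /cosh Ropp_involutive Rplus_comm. Qed.

Lemma sinh_opp y : sinh (- y) = - sinh y.
Proof. by rewrite /sinh Ropp_involutive; field. Qed.

(** For [y >= 0], [exp y = exp (y/2)^2 >= (1 + y/2)^2 >= y^2 / 4]. A quadratic lower bound makes
    [1 / cosh] summable. *)
Lemma cosh_ge_sqr y : y ^ 2 / 8 <= cosh y.
Proof.
wlog y0 : y / 0 <= y => [H|].
  case: (Rle_dec 0 y) => [|n]; first exact: H.
  by have := H (- y) ltac:(lra); rewrite cosh_opp (_ : (- y) ^ 2 = y ^ 2) //; ring.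
have := exp_pos (- y); have := exp_ineq1_le (y / 2).
have E : exp y = exp (y / 2) * exp (y / 2) by rewrite -exp_plus; congr exp; field.
rewrite /cosh E; move: (exp (y / 2)) {E} => e ? ?.
have : y ^ 2 / 4 <= e * e by rewrite /=; nra.
lra.
Qed.

Lemma ex_series_sech b : b <> 0 -> ex_series (fun n => / cosh (INR n.+1 * b)).
Proof.
move=> b0; have bb := pow2_gt_0 b b0.
apply: (ex_series_dom _ (fun n => 8 / b ^ 2 * / INR n.+1 ^ 2)); last first.
  exact: (ex_series_scal_l (8 / b ^ 2) _ ex_series_inv_sqr).
move=> n; have n0 : 0 < INR n.+1 by apply: lt_0_INR; lia.
rewrite Rabs_pos_eq; last by apply/Rlt_le/Rinv_0_lt_compat/cosh_gt0.
rewrite (_ : 8 / b ^ 2 * / INR n.+1 ^ 2 = / ((INR n.+1 * b) ^ 2 / 8)); last by field; lra.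
apply: Rinv_le_contravar; last exact: cosh_ge_sqr.
by apply: Rdiv_lt_0_compat; [apply: pow2_gt_0;
  apply: Rmult_integral_contrapositive_currified; lra|lra].
Qed.

Lemma ex_Cseries_sech_bounded (z : nat -> C) (w : R -> R) b K : b <> 0 ->
  (forall n, Cmod (z n) <= K) -> sech_bounded w ->
  ex_Cseries (fun n => z n * RtoC (w (Rmult (INR n.+1) b)))%C.
Proof.
move=> b0 zK [M HM].
apply: (ex_Cseries_dom _ (fun n => (K * M) * / cosh (INR n.+1 * b))); last first.
  exact: (ex_series_scal_l (K * M) _ (ex_series_sech b b0)).
move=> n; rewrite Cmod_mult Cmod_R Rmult_assoc.
by apply: Rmult_le_compat => //; [exact: Cmod_ge_0|exact: Rabs_pos].
Qed.

(** With [eps = 1], [|g m| <= 1/|m| <= 1] for large [|m|]; induction bounds the finitely many other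
    values. A negative threshold [N] is raised to 0, so [m] is nonzero in the first case. *)
Lemma domin_bounded (g : Z -> C) :
  @is_domin Z R_AbsRing C_AbsRing R_NormedModule C_NormedModule
    Zabs_infty (fun m : Z => / IZR m) g ->
  exists K, forall m, Cmod (g m) <= K.
Proof.
move=> H; have [N HN] := H (mkposreal 1 Rlt_0_1).
have [K HK] : exists K, forall m, (Z.abs m <= Z.of_nat (Z.to_nat N))%Z -> Cmod (g m) <= K.
  elim: (Z.to_nat N) => [|n [K HK]].
    by exists (Cmod (g 0%Z)) => m Hm; rewrite (_ : m = 0%Z); [exact: Rle_refl|lia].
  exists (Rmax K (Rmax (Cmod (g (Z.of_nat n.+1))) (Cmod (g (- Z.of_nat n.+1)%Z)))) => m Hm.
  have [h|[h|h]] : (Z.abs m <= Z.of_nat n)%Z \/ m = Z.of_nat n.+1 \/ m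
    = (- Z.of_nat n.+1)%Z by lia.
  - exact: Rle_trans (HK m h) (Rmax_l _ _).
  - by rewrite h; apply: Rle_trans (Rmax_r _ _); apply: Rmax_l.
  - by rewrite h; apply: Rle_trans (Rmax_r _ _); apply: Rmax_r.
exists (Rmax K 1) => m; case: (Z_le_gt_dec (Z.abs m) (Z.of_nat (Z.to_nat N))) => Hm.
  exact: Rle_trans (HK m Hm) (Rmax_l _ _).
apply: Rle_trans (Rmax_r _ _); have := HN m ltac:(lia).
rewrite /= Rmult_1_l => h; apply: Rle_trans h _.
rewrite -[norm _]/(Rabs (/ IZR m)) Rabs_inv -Rinv_1.
apply: Rinv_le_contravar; first by lra.
rewrite -abs_IZR; apply: IZR_le; lia.
Qed.

(** * The double sums *)

Lemma inv_line_scale (a x : R) (n p : nat) : a <> 0 ->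
  let r := PI / (2 * a) in
  (/ (RtoC x + RtoC (a * (2 * INR n + 1)) * Ci) ^ p
    = RtoC (r ^ p) * inv_line (x * r) (theta n) ^ p)%C.
Proof.
move=> a0 r; have p0 := PI_RGT_0.
have r0 : r <> 0 by apply: Rmult_integral_contrapositive_currified;
  [lra|apply: Rinv_neq_0_compat; lra].
set z := (_ + _)%C.
have zE : z = (x, a * (2 * INR n + 1)).
  by rewrite /z /Cplus /Cmult /RtoC /=; congr (_, _); ring.
have z0 : z <> RtoC 0.
  rewrite zE; apply: pair_neq0; apply: Rmult_integral_contrapositive_currified => //.
  by have := pos_INR n; lra.
have E : (x * r, theta n) = (RtoC r * z)%C.
  rewrite zE /Cmult /RtoC /theta /=; congr (_, _); first by ring.
  by rewrite /r; field.
have r0' : RtoC r <> RtoC 0 by move=> [].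
rewrite RtoC_pow -Cpow_mult_l /inv_line E -Cpow_inv //; congr (Cpow _ _).
by field; split.
Qed.

(** The reflection [n -> -n-1] changes the sign of [2n+1], so apart from the factor [z] the negative
    half is the conjugate of the other and the imaginary parts cancel. The exponent [p+2] makes each
    half converge on its own. *)
Lemma is_sumZ_eis (z : C) (a x : R) (p : nat) : a <> 0 ->
  is_sumZ (fun n => z / (RtoC x + RtoC (a * IZR (2 * n + 1)) * Ci) ^ p.+2)%C
    (z * RtoC ((PI / (2 * a)) ^ p.+2 * (2 * eis p.+2 (x * (PI / (2 * a))))))%C.
Proof.
move=> a0; set r := PI / (2 * a); set y := x * r.
pose I := Series (fun n => Im (inv_line y (theta n) ^ p.+2)%C).
have exI : ex_series (fun n => Im (inv_line y (theta n) ^ p.+2)%C).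
  apply: ex_series_dom ex_series_inv_sqr => n.
  exact: Rle_trans (Im_le_Cmod _) (inv_line_pow_le _ _ _).
have H1 : is_Cseries (fun n => inv_line y (theta n) ^ p.+2)%C (eis p.+2 y, I).
  by apply: is_Cseries_pair; apply: Series_correct; [exact: ex_eis|].
have H2 : is_Cseries (fun n => Cconj (inv_line y (theta n) ^ p.+2))%C (eis p.+2 y, - I).
  apply: is_Cseries_pair; first by apply: Series_correct; exact: ex_eis.
  apply: (@is_series_opp _ R_NormedModule (fun n => Im (inv_line y (theta n) ^ p.+2)%C) I).
  exact: Series_correct.
exists (z * RtoC (r ^ p.+2) * (eis p.+2 y, I))%C, (z * RtoC (r ^ p.+2) * (eis p.+2 y, Ropp
  I))%C.
split; [|split].
- apply: is_Cseries_ext (is_Cseries_scal _ _ _ H1) => n.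
  rewrite (_ : IZR (2 * Z.of_nat n + 1) = 2 * INR n + 1); last first.
    by rewrite plus_IZR mult_IZR INR_IZR_INZ.
  by rewrite /Cdiv inv_line_scale // Cmult_assoc.
- apply: is_Cseries_ext (is_Cseries_scal _ _ _ H2) => n.
  rewrite (_ : IZR (2 * - Z.of_nat n.+1 + 1) = - (2 * INR n + 1)); last first.
    rewrite plus_IZR mult_IZR opp_IZR -INR_IZR_INZ S_INR; ring.
  rewrite (_ : RtoC (r ^ p.+2) = Cconj (RtoC (r ^ p.+2)));
    last by rewrite /Cconj /RtoC /= Ropp_0.
  rewrite -Cmult_assoc -Cmult_conj -inv_line_scale // /Cdiv; congr (_ * _)%C.
  rewrite Cinv_conj ?Cpow_conj; last first.
    apply: Cpow_nz => -[_ /=]; have := pos_INR n; move: (INR n) => N N0 E.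
    have : a * (2 * N + 1) = 0 by lra.
    by apply: Rmult_integral_contrapositive_currified => //; lra.
  congr (/ _ ^ _)%C; rewrite /Cconj /Cplus /Cmult /=; congr (_, _); ring.
- move: (eis _ _) (r ^ _) I {exI H1 H2} => e q I.
  by case: z => u v; rewrite /Cplus /Cmult /RtoC /=; congr (_, _); ring.
Qed.

(** Treats both parities of the exponent: [sg] is the parity of the functions [t l] and folds [m]
    with [-m], and [q] collects the constants. *)
Lemma double_sum_dsum (g : Z -> C) (k p : nat) (a K sg q : R)
    (c : nat -> nat -> R) (t : nat -> R -> R) :
  (forall m, Cmod (g m) <= K) -> a <> 0 ->
  (forall l, sech_bounded (t l.+1)) ->
  (forall l y, t l (- y) = sg * t l y) ->
  (forall y, (PI / (2 * a)) ^ p.+2 * (2 * eis p.+2 y) =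
     q * dsum c (cut0 (fun l => t l y)) k) ->
  let term l n := ((g (Z.of_nat n.+1) + RtoC sg * g (- Z.of_nat n.+1)%Z)
     * RtoC (t l (Rmult (INR n.+1) (Rdiv PI (Rmult 2 a)))))%C in
  (forall l, ex_Cseries (term l.+1)) /\
  is_double_sum (fun m n => g m / (RtoC (IZR m) + RtoC (a * IZR (2 * n + 1)) * Ci) ^ p.+2)%C
    (RtoC q * Cdsum c (Ccut0 (fun l => CSeries (term l))) k)%C.
Proof.
move=> gK a0 tb tp eisW term; have p0 := PI_RGT_0; set b := PI / (2 * a) in eisW term *.
have b0 : b <> 0 by apply: Rmult_integral_contrapositive_currified;
  [lra|apply: Rinv_neq_0_compat; lra].
have exT l : ex_Cseries (term l.+1).
  apply: (ex_Cseries_sech_bounded (fun n => g (Z.of_nat n.+1)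
    + RtoC sg * g (- Z.of_nat n.+1)%Z)%C _ b (K + Rabs sg * K)) => // n.
  apply: Rle_trans (Cmod_triangle _ _) _; rewrite Cmod_mult Cmod_R.
  by apply: Rplus_le_compat => //; apply: Rmult_le_compat_l (gK _); exact: Rabs_pos.
split=> //.
(* By the hypothesis on [eis], [w (m b)] is the inner sum without the factor [g m]. *)
pose w y := q * dsum c (cut0 (fun l => t l y)) k.
have wb : sech_bounded w.
  apply: sech_bounded_scal; apply: (@sech_bounded_dsum c (fun l y => cut0 (fun l
    => t l y) l)) => -[|l]; last exact: tb.
  exact: sech_bounded_0.
have wp y : w (- y) = sg * w y.
  rewrite /w -Rmult_assoc (Rmult_comm sg) Rmult_assoc; congr (_ * _).
  rewrite /dsum -sum_nZ; apply: eq_sum_n => j _; rewrite -sum_nZ;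
    apply: eq_sum_n => -[|l] _ /=; first by ring.
  by rewrite tp; ring.
exists (fun m => g m * RtoC (w (Rmult (IZR m) b)))%C; split.
  by move=> m _; rewrite /w -eisW; exact: is_sumZ_eis.
have [s1 H1] := ex_Cseries_sech_bounded (fun n => g (Z.of_nat n.+1)) w b K b0 (fun n
  => gK _) wb.
have [s2 H2] := ex_Cseries_sech_bounded (fun n
  => RtoC sg * g (- Z.of_nat n.+1)%Z)%C w b (Rabs sg * K) b0
  ltac:(move=> n; rewrite Cmod_mult Cmod_R; apply: Rmult_le_compat_l (gK _);
    exact: Rabs_pos) wb.
exists s1, s2; split; [|split].
- by apply: is_Cseries_ext H1 => n; rewrite -INR_IZR_INZ.
- apply: is_Cseries_ext H2 => n; rewrite opp_IZR -INR_IZR_INZ Ropp_mult_distr_l_reverse wp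
  RtoC_mult; ring.
(* The folded series converges to [s1 + s2]. Splitting it along the finite double sum, where each
   series with [l >= 1] converges, computes the same limit. *)
apply: is_Cseries_unique (is_Cseries_plus _ _ _ _ H1 H2).
have H3 : is_Cseries (fun n => Cdsum c (Ccut0 (fun l => term l n)) k)
    (Cdsum c (Ccut0 (fun l => CSeries (term l))) k).
  apply: (@is_Cseries_Cdsum c (fun n => Ccut0 (fun l => term l n))) => -[|l];
    last exact: (CSeries_correct _ (exT l)).
  exact: is_Cseries_0.
apply: is_Cseries_ext (is_Cseries_scal (RtoC q) _ _ H3) => n.
rewrite (_ : Cdsum _ _ k = Cdsum c (fun l => (g (Z.of_nat n.+1)
  + RtoC sg * g (- Z.of_nat n.+1)%Z) * RtoC (cut0 (fun l
    => t l (Rmult (INR n.+1) b)) l))%C k); last first.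
  by apply: eq_Csum => j _; apply: eq_Csum => -[|l] _ //=; rewrite !Cmult_0_r.
by rewrite Cdsum_factor /w RtoC_mult; ring.
Qed.

Lemma CSeries_ext (u v : nat -> C) : (forall n, u n = v n) -> CSeries u = CSeries v.
Proof. by move=> E; rewrite /CSeries; congr (_, _); apply: Series_ext => n; rewrite E. Qed.

Lemma is_double_sum_eq (F : Z -> Z -> C) (s t : C) :
  is_double_sum F s -> s = t -> is_double_sum F t.
Proof. by move=> H <-. Qed.

(** The sign [(-1)^(2k-1) = -1] from [eisE] cancels the minus sign in [tanh_deriv_odd]. *)
Lemma eis_even k r y : (0 < k)%N -> r ^ (2 * k) * (2 * eis (2 * k) y) =
  r ^ (2 * k) / INR (2 * k - 1)`! * dsum (even_coef k) (cut0 (fun l => / cosh y ^ (2 * l))) k.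
Proof.
move=> k0; have [p Ep] : exists p, (2 * k = p.+2)%N by exists (2 * k - 2)%N; lia.
have F0 : INR (p.+1)`! <> 0 by apply: not_0_INR; have := fact_gt0 p.+1; lia.
have Ep1 : (2 * k - 1 = p.+1)%N by lia.
have := tanh_deriv_odd k y k0; move: (dsum _ _ _) => d; rewrite Ep1 Ep eisE => ->.
have -> : (-1) ^ p.+1 = -1.
  have -> : p.+1 = (2 * (k - 1)).+1 by lia.
  by rewrite -[LHS]/(-1 * (-1) ^ (2 * (k - 1))) pow_1_even Rmult_1_r.
by field.
Qed.

Lemma eis_odd k r y : (0 < k)%N -> r ^ (2 * k + 1) * (2 * eis (2 * k + 1) y) =
  r ^ (2 * k + 1) / INR (2 * k)`!
  * dsum (odd_coef k) (cut0 (fun l => sinh y * / cosh y ^ (2 * l + 1))) k.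
Proof.
move=> k0; have [p Ep] : exists p, (2 * k = p.+1)%N by exists (2 * k - 1)%N; lia.
have F0 : INR (p.+1)`! <> 0 by apply: not_0_INR; have := fact_gt0 p.+1; lia.
have := tanh_deriv_even0 k y k0; move: (dsum _ _ _) => d.
have sg : (-1) ^ (2 * k) = 1 by exact: pow_1_even.
rewrite addn1; rewrite Ep in sg *; rewrite eisE sg => ->.
by field.
Qed.

Theorem theorem3p4 (g : Z -> C) (k : nat) (a : R) :
  @is_domin Z R_AbsRing C_AbsRing R_NormedModule C_NormedModule
    Zabs_infty (fun m : Z => / IZR m) g ->
  (0 < k)%N ->
  a <> 0 ->
  let even_term (l : nat) (m : nat) : C :=
    ((g (Z.of_nat m) + g (- Z.of_nat m)%Z)
       / RtoC (cosh (INR m * PI / (2 * a)) ^ (2 * l)))%C in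
  let odd_term (l : nat) (m : nat) : C :=
    ((g (Z.of_nat m) - g (- Z.of_nat m)%Z) * RtoC (sinh (INR m * PI / (2 * a)))
       / RtoC (cosh (INR m * PI / (2 * a)) ^ (2 * l + 1)))%C in
  ((forall l : nat, (1 <= l)%N -> ex_Cseries (fun n => even_term l n.+1)) /\
   is_double_sum
     (fun m n : Z =>
        (g m / (RtoC (IZR m) + RtoC (a * IZR (2 * n + 1)) * Ci) ^ (2 * k))%C)
     (RtoC (PI ^ (2 * k) / ((2 * a) ^ (2 * k) * INR (2 * k - 1)`!))
      * @sum_n_m C_AbelianMonoid (fun j =>
          @sum_n_m C_AbelianMonoid (fun l =>
            RtoC ((INR 'C(2 * k, 2 * j) * INR (2 * l - 1)`!
                   - INR 'C(2 * k, 2 * j + 1) * INR (2 * l - 1)`!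
                       * INR (2 * l + 1))
                  * (-1) ^ l * INR (S_sum j l))
            * CSeries (fun n => even_term l n.+1)) 1 j) 1 k)%C)
  /\
  ((forall l : nat, (1 <= l)%N -> ex_Cseries (fun n => odd_term l n.+1)) /\
   is_double_sum
     (fun m n : Z =>
        (g m / (RtoC (IZR m) + RtoC (a * IZR (2 * n + 1)) * Ci)
                 ^ (2 * k + 1))%C)
     (RtoC (PI ^ (2 * k + 1) / ((2 * a) ^ (2 * k + 1) * INR (2 * k)`!))
      * @sum_n_m C_AbelianMonoid (fun j =>
          @sum_n_m C_AbelianMonoid (fun l =>
            RtoC ((INR 'C(2 * k, 2 * j) * INR (2 * l)`!
                   - INR 'C(2 * k, 2 * j + 1) * INR (2 * l + 1)`!)
                  * (-1) ^ l * INR (S_sum j l))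
            * CSeries (fun n => odd_term l n.+1)) 0 j) 0 k)%C).
Proof.
move=> domin k0 a0; have [K gK] := domin_bounded g domin.
have argE m : INR m * PI / (2 * a) = INR m * (PI / (2 * a)) by rewrite /Rdiv Rmult_assoc.
have a2 : 2 * a <> 0 by lra.
have powE p : (PI / (2 * a)) ^ p = PI ^ p / (2 * a) ^ p.
  by rewrite /Rdiv Rpow_mult_distr pow_inv.
have invE x n : (/ RtoC (cosh x ^ n))%C = RtoC (/ cosh x ^ n).
  by rewrite RtoC_inv //; apply: pow_nonzero; have := cosh_gt0 x; lra.
move=> even_term odd_term; split.
- pose p := (2 * k - 2)%N; have Ep : (2 * k = p.+2)%N by rewrite /p; lia.
  pose q := PI ^ (2 * k) / ((2 * a) ^ (2 * k) * INR (2 * k - 1)`!).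
  pose t l y := / cosh y ^ (2 * l).
  have tb l : sech_bounded (t l.+1).
    by rewrite /t (_ : 2 * l.+1 = (2 * l).+2)%N; [exact: sech_bounded_pow|lia].
  have tp l y : t l (- y) = 1 * t l y by rewrite /t cosh_opp Rmult_1_l.
  have W y : (PI / (2 * a)) ^ p.+2 * (2 * eis p.+2 y)
    = q * dsum (even_coef k) (cut0 (fun l => t l y)) k.
    rewrite -Ep eis_even // powE /q /Rdiv Rinv_mult /t; ring.
  have [exT dS] := double_sum_dsum g k p a K 1 q _ t gK a0 tb tp W.
  have E l n : even_term l n.+1 = ((g (Z.of_nat n.+1) + RtoC 1 * g (- Z.of_nat n.+1)%Z)
     * RtoC (t l (Rmult (INR n.+1) (Rdiv PI (Rmult 2 a)))))%C.
    by rewrite /even_term argE /Cdiv invE Cmult_1_l.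
  split.
    case=> // l _; have [s Hs] := exT l; exists s.
    by apply: is_Cseries_ext Hs => n; rewrite E.
  rewrite -Ep in dS; apply: is_double_sum_eq dS _.
  congr Cmult; rewrite -Cdsum_from1; apply: sum_n_m_ext => j; apply: sum_n_m_ext => l.
  by congr Cmult; apply: CSeries_ext => n; rewrite E.
pose p := (2 * k - 1)%N; have Ep : (2 * k + 1 = p.+2)%N by rewrite /p; lia.
pose q := PI ^ (2 * k + 1) / ((2 * a) ^ (2 * k + 1) * INR (2 * k)`!).
pose t l y := sinh y * / cosh y ^ (2 * l + 1).
have tb l : sech_bounded (t l.+1).
  by rewrite /t (_ : 2 * l.+1 + 1 = (2 * l).+3)%N; [exact: sech_bounded_sinh_pow|lia].
have tp l y : t l (- y) = -1 * t l y by rewrite /t cosh_opp sinh_opp; ring.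
have W y : (PI / (2 * a)) ^ p.+2 * (2 * eis p.+2 y)
  = q * dsum (odd_coef k) (cut0 (fun l => t l y)) k.
  rewrite -Ep eis_odd // powE /q /Rdiv Rinv_mult /t; ring.
have [exT dS] := double_sum_dsum g k p a K (-1) q _ t gK a0 tb tp W.
have E l n : odd_term l n.+1 = ((g (Z.of_nat n.+1) + RtoC (-1) * g (- Z.of_nat n.+1)%Z)
   * RtoC (t l (Rmult (INR n.+1) (Rdiv PI (Rmult 2 a)))))%C.
  by rewrite /odd_term argE /Cdiv invE /t RtoC_mult (_ : RtoC (-1) = (- RtoC 1)%C);
    [ring|rewrite -RtoC_opp].
split.
  case=> // l _; have [s Hs] := exT l; exists s.
  by apply: is_Cseries_ext Hs => n; rewrite E.
rewrite -Ep in dS; apply: is_double_sum_eq dS _.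
(* The terms with [l = 0] are put back here: their coefficients sum to 0, whatever value [CSeries]
   gives the [tanh] series. *)
congr Cmult; rewrite -Cdsum_odd_cut0 //; apply: sum_n_ext => j; apply: sum_n_ext => l.
by congr Cmult; apply: CSeries_ext => n; rewrite E.
Qed.
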